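(* Let $p\in(0,1)$ and let $c_p=c_p(m)$ be the $p$-quantile of the distribution of $(m+1)\ln(Y)-mY-Z$, where $Y\sim\Gamma(m-1,1/m)$ and $Z$ is standard exponential, independent. Define $$C_3=\Big\{(\mu,\sigma)\in(-\infty,\hat\mu]\times(0,\infty):\ (m+1)\ln\Big(\frac{\hat\sigma}{\sigma}\Big)-\frac{n(\hat\mu-\mu)+m\hat\sigma}{\sigma}\ge c_p\Big\},$$ $$g(z)=\frac{[c_p-(m+1)(\ln\hat\sigma-\ln z)]\,z+m\hat\sigma}{n},\quad z>0,$$ $$Z_i=-\frac{m\hat\sigma}{m+1}\Big[W_i\Big(-\frac{m}{m+1}\exp\Big\{\frac{c_p}{m+1}\Big\}\Big)\Big]^{-1},\quad i\in\{-1,0\},$$ and $\sigma^*_x=\frac{n(\hat\mu-x)+m\hat\sigma}{m+1}$ for $x\in\mathbb{R}$. Then $B_3=\bigcup_{\tilde\vartheta\in C_3}\mathrm{graph}\,F_{\tilde\vartheta}$ is a confidence band for $F_\vartheta$ with confidence level at least $1-p$ (i.e. $P_\vartheta(\mathrm{graph}\,F_\vartheta\subseteq B_3)\ge1-p$ for all $\vartheta$), and $$B_3=\{(x,y)\in\mathbb{R}\times[0,1]:\ U_3(x)\le y\le O_3(x)\},$$ where $U_3(x)=F_{(\hat\mu,Z_0)}(x)$ for $x\in\mathbb{R}$ and $$O_3(x)=\begin{cases}F_{(\hat\mu,Z_{-1})}(x),&\sigma^*_x<Z_{-1}\\ F_{(\hat\mu+g(\sigma^*_x),\sigma^*_x)}(x),&Z_{-1}\le\sigma^*_x\le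 Z_0\\ F_{(\hat\mu,Z_0)}(x),&\sigma^*_x>Z_0\end{cases}.$$
   Context: Let $1<m\le n$ be integers and $(R_1,\dots,R_m)\in\mathbb{N}_0^m$ with $\sum_{j=1}^mR_j=n-m$; set $\gamma_j=\sum_{i=j}^m(R_i+1)$. A sample of progressively type-II censored order statistics $X=(X_{1:m:n},\dots,X_{m:m:n})$ from an absolutely continuous cdf $F$ with density $f$ has joint density $\prod_{j=1}^m\gamma_jf(x_j)[1-F(x_j)]^{R_j}$ on $x_1\le\dots\le x_m$. Here $F=F_\vartheta$ belongs to the exponential location-scale family: for $\vartheta=(\mu,\sigma)\in\Theta=\mathbb{R}\times(0,\infty)$, $F_\vartheta(x)=1-\exp\{-(x-\mu)/\sigma\}$ for $x>\mu$ and $F_\vartheta(x)=0$ for $x\le\mu$; $\vartheta$ is unknown and $P_\vartheta$ denotes the underlying probability. The MLEs are $\hat\mu=X_{1:m:n}$ and $\hat\sigma=\frac1m\sum_{j=2}^m\gamma_j(X_{j:m:n}-X_{j-1:m:n})$. $\Gamma(a,b)$ is the gamma distribution with shape $a$ and scale $b$. $W_{-1}$ and $W_0$ are the real branches of the Lambert W-function, i.e. the inverses of $x\mapsto xe^x$ on $x\le-1$ and $x\ge-1$, respectively. $\mathrm{graph}\,F=\{(t,F(t)):t\in\mathbb{R}\}$. A confidence band is a random subset $B$ of $\mathbb{R}^2$ such that $\{\mathrm{graph}\,F_\vartheta\subseteq B\}$ is measurable and the vertical sections $\{y:(t,y)\in B\}$ are a.s. intervals. (The set $C_3$ is a confidence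 region for $\vartheta$ with exact level $1-p$, i.e. $P_\vartheta(\vartheta\in C_3)=1-p$.) *)

(* Defs.v *)
From HB Require Import structures.
From mathcomp Require Import all_boot all_order all_algebra.
From mathcomp Require Import all_classical all_reals all_analysis.
Set Implicit Arguments. Unset Strict Implicit. Unset Printing Implicit Defensive.
Import Order.TTheory GRing.Theory Num.Theory.
Import numFieldNormedType.Exports.
Local Open Scope classical_set_scope.
Local Open Scope ring_scope.

Section Defs.
Variable R : realType.

Definition Fexp (mu sigma x : R) : R :=
  if x <= mu then 0 else 1 - expR (- ((x - mu) / sigma)).
Definition fexp (mu sigma x : R) : R :=
  if x <= mu then 0 else sigma^-1 * expR (- ((x - mu) / sigma)).

Definition graph (F : R -> R) : set (R * R) := [set xy | xy.2 = F xy.1].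

(* gamma_j = sum_{i=j}^m (R_i + 1), with 0-based indices j, i in {0..m-1} *)
Definition gam (m : nat) (cs : nat -> nat) (j : nat) : nat :=
  (\sum_(j <= i < m) (cs i).+1)%N.

(* joint density of progressively type-II censored order statistics *)
Definition pcos_density (m : nat) (cs : nat -> nat) (mu sigma : R)
  (t : m.-tuple R) : R :=
  if [forall i : 'I_m, forall j : 'I_m, (i <= j)%N ==> (tnth t i <= tnth t j)]
  then \prod_(j < m) ((gam m cs j)%:R * fexp mu sigma (tnth t j) *
                        (1 - Fexp mu sigma (tnth t j)) ^+ cs j)
  else 0.

(* m-fold iterated Lebesgue integral on R^m (= integral w.r.t. the m-fold
   product Lebesgue measure for nonnegative measurable integrands, Tonelli) *)
Fixpoint iter_integral (k : nat) : (k.-tuple R -> \bar R) -> \bar R :=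
  match k return (k.-tuple R -> \bar R) -> \bar R with
  | 0 => fun f => f [tuple]
  | k'.+1 => fun f =>
      (\int[lebesgue_measure]_(x in [set: R])
          iter_integral (fun t : k'.-tuple R => f (cons_tuple x t)))%E
  end.

Definition has_joint_density d (Omega : measurableType d)
  (P : probability Omega R) (k : nat) (X : Omega -> k.-tuple R)
  (h : k.-tuple R -> R) : Prop :=
  forall A : set (k.-tuple R), measurable A ->
    P (X @^-1` A) = iter_integral (fun t => (\1_A t * h t)%:E).

(* MLEs *)
Definition muhat (m : nat) (t : m.-tuple R) : R := t`_0.
Definition sighat (m : nat) (cs : nat -> nat) (t : m.-tuple R) : R :=
  m%:R^-1 * \sum_(1 <= j < m) (gam m cs j)%:R * (t`_j - t`_(j.-1)).

(* density of Gamma(k, b) (shape k >= 1 integer, scale b), Gamma(k) = (k-1)! *)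
Definition gamma_pdf (k : nat) (b y : R) : R :=
  if 0 < y then y ^+ k.-1 * expR (- (y / b)) / ((k.-1)`!%:R * b ^+ k) else 0.

Definition T_cdf (m : nat) (c : R) : \bar R :=
  (\int[lebesgue_measure]_(y in [set: R]) \int[lebesgue_measure]_(z in [set: R])
     ((if (m.+1%:R * ln y - m%:R * y - z <= c) then 1 else 0)
        * gamma_pdf m.-1 m%:R^-1 y * fexp 0 1 z)%:E)%E.

Definition cp (m : nat) (p : R) : R := inf [set c | (p%:E <= T_cdf m c)%E].

Definition W0 (y : R) : R := xget 0 [set w | -1 <= w /\ w * expR w = y].
Definition Wm1 (y : R) : R := xget 0 [set w | w <= -1 /\ w * expR w = y].

Definition C3 (m n : nat) (c muh sh mu sigma : R) : Prop :=
  [/\ mu <= muh, 0 < sigma &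
   c <= m.+1%:R * ln (sh / sigma) - (n%:R * (muh - mu) + m%:R * sh) / sigma].
Definition B3 (m n : nat) (c muh sh : R) : set (R * R) :=
  [set xy | exists mu sigma, C3 m n c muh sh mu sigma /\ graph (Fexp mu sigma) xy].

Definition gfun (m n : nat) (c sh z : R) : R :=
  ((c - m.+1%:R * (ln sh - ln z)) * z + m%:R * sh) / n%:R.
Definition Warg (m : nat) (c : R) : R := - (m%:R / m.+1%:R) * expR (c / m.+1%:R).
Definition Z0 (m : nat) (c sh : R) : R := - (m%:R * sh / m.+1%:R) * (W0 (Warg m c))^-1.
Definition Zm1 (m : nat) (c sh : R) : R := - (m%:R * sh / m.+1%:R) * (Wm1 (Warg m c))^-1.
Definition sigstar (m n : nat) (muh sh x : R) : R :=
  (n%:R * (muh - x) + m%:R * sh) / m.+1%:R.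

Definition U3 (m : nat) (c muh sh x : R) : R := Fexp muh (Z0 m c sh) x.
Definition O3 (m n : nat) (c muh sh x : R) : R :=
  let s := sigstar m n muh sh x in
  if s < Zm1 m c sh then Fexp muh (Zm1 m c sh) x
  else if s <= Z0 m c sh then Fexp (muh + gfun m n c sh s) s x
  else Fexp muh (Z0 m c sh) x.

End Defs.
Arguments pcos_density {R} m cs mu sigma t.
Arguments sighat {R} m cs t.
Arguments muhat {R} m t.

(* Main.v *)
Require Import Defs.
From HB Require Import structures.
From mathcomp Require Import all_boot all_order all_algebra.
From mathcomp Require Import all_classical all_reals all_analysis.
From mathcomp Require Import measurable_realfun ring lra.
Import Order.TTheory GRing.Theory Num.Theory.
Import numFieldNormedType.Exports.
Local Open Scope classical_set_scope.
Local Open Scope ring_scope.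

(* Writing [sh], [a] for the two MLEs, [C3] is the set of [(mu, s)] with
   [a + g s <= mu <= a], and [g s <= 0] means that [w = - m sh / ((m + 1) s)]
   satisfies [w exp w <= - m / (m + 1) exp (c / (m + 1))], i.e. that [w] lies
   between the two Lambert branches, i.e. [Zm1 <= s <= Z0].  At abscissa [x] the
   smallest ordinate is attained at [(a, Z0)]; the largest one maximizes
   [(x - a - g s) / s = const - (m + 1) / n * (sigstar / s + ln s)], which by
   [ln u <= u - 1] happens at [sigstar] clamped to [[Zm1, Z0]].

   For the level, integrating out the order statistics from the last to the first
   turns the normalized spacings into independent exponentials, so that
   [sh / sigma] and [n (a - mu) / sigma] are independent with laws
   Gamma(m - 1, 1 / m) and Exp(1).  Hence the pivot defining [C3] has cdf [T_cdf],
   is below its [p]-quantile with probability at most [p], and that quantile is at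
   most the maximum of the pivot, as the Lambert branches require. *)

(** * The band as a region between two curves *)

Section Lambert.
Context {R : realType}.
Implicit Types w y : R.

(** Factor out [expR w]: since [w' < 0], the strict tangent bound [1 + d < expR d] at [d = w' - w]
    gives [w' * expR d < w' + w' * d], which is at most [w' - d = w] because [w' <= -1]. *)
Lemma mulr_expR_decr w w' : w < w' -> w' <= -1 -> w' * expR w' < w * expR w.
Proof.
move=> ww' w'1; have -> : expR w' = expR (w + (w' - w)) by congr expR; ring.
rewrite expRD [expR w * _]mulrC mulrA ltr_pM2r ?expR_gt0//.
have h : 1 + (w' - w) < expR (w' - w) by rewrite expR_gt1Dx// subr_eq0 gt_eqF.
nra.
Qed.

(** The same tangent bound with [expR w'] factored out; now [-1 <= w] controls the product
    [w * (w - w')]. *)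
Lemma mulr_expR_incr w w' : -1 <= w -> w < 0 -> w < w' ->
  w * expR w < w' * expR w'.
Proof.
move=> w1 w0 ww'; have -> : expR w = expR (w' + (w - w')) by congr expR; ring.
rewrite expRD [expR w' * _]mulrC mulrA ltr_pM2r ?expR_gt0//.
have h : 1 + (w - w') < expR (w - w') by rewrite expR_gt1Dx// subr_eq0 lt_eqF.
nra.
Qed.

Lemma continuous_mulr_expR : continuous (fun w => w * expR w).
Proof. by move=> w; apply: cvgM; [exact: cvg_id|exact: continuous_expR]. Qed.

(** The default value of [xget] is never returned, since the intermediate value theorem on [[-1, 0]]
    supplies a witness. *)
Lemma W0_spec y : - expR (-1) <= y -> y < 0 ->
  [/\ -1 <= W0 y, W0 y < 0 & W0 y * expR (W0 y) = y].
Proof.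
move=> y1 y0; have [w] : exists2 w, w \in `[-1, 0] & w * expR w = y.
  apply: IVT => //; first by apply: continuous_subspaceT; exact: continuous_mulr_expR.
  by rewrite mulN1r mul0r ge_min le_max y1 (ltW y0) orbT.
rewrite in_itv /= => /andP[w1 w0] wy.
have [h1 h2] : -1 <= W0 y /\ W0 y * expR (W0 y) = y.
  by rewrite /W0; case: xgetP => [x _ //|/(_ w)/=]; case.
split => //; rewrite ltNge; apply/negP => h.
by move: y0; rewrite -h2 ltNge mulr_ge0// expR_ge0.
Qed.

Lemma Wm1_spec y : - expR (-1) <= y -> y < 0 ->
  Wm1 y <= -1 /\ Wm1 y * expR (Wm1 y) = y.
Proof.
move=> y1 y0.
(* [expR v >= v^2 / 4], so [w expR w >= y] already at [w = 4 / y]. *)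
pose v := Num.max 1 (4 / - y).
have v1 : 1 <= v by rewrite le_max lexx.
have vy : 4 / - y <= v by rewrite le_max lexx orbT.
have hv : - v * expR (- v) >= y.
  have e : v / 2 <= expR (v / 2) by apply: le_trans (expR_ge1Dx _); lra.
  have e2 : expR v = expR (v / 2) * expR (v / 2).
    by rewrite -expRD; congr expR; lra.
  have e3 : v * v / 4 <= expR v by rewrite e2; nra.
  have e4 : 4 <= - y * v by rewrite mulrC -ler_pdivrMr// oppr_gt0.
  have e5 : v <= - y * expR v by nra.
  by rewrite expRN mulNr lerNr ler_pdivrMr ?expR_gt0.
have [w] : exists2 w, w \in `[- v, -1] & w * expR w = y.
  apply: IVT => //; first by rewrite lerN2.
    by apply: continuous_subspaceT; exact: continuous_mulr_expR.
  by rewrite mulN1r ge_min le_max y1 hv orbT.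
rewrite in_itv /= => /andP[_ w1] wy.
by rewrite /Wm1; case: xgetP => [x _ //|/(_ w)/=]; case.
Qed.

(** On the negative axis [w * expR w] falls up to [-1] and rises afterwards, so its sublevel sets
    are intervals whose endpoints are the two branches. *)
Lemma mulr_expR_le y w : - expR (-1) <= y -> y < 0 -> w < 0 ->
  (w * expR w <= y) = (Wm1 y <= w <= W0 y).
Proof.
move=> y1 y0 w0; have [u1 u0 uE] := W0_spec y y1 y0.
have [v1 vE] := Wm1_spec y y1 y0.
apply/idP/andP => [wy|[vw wu]].
  split; rewrite leNgt; apply/negP => h.
    by have := mulr_expR_decr _ _ h v1; rewrite vE ltNge wy.
  by have := mulr_expR_incr _ _ u1 u0 h; rewrite uE ltNge wy.
have [w1|/ltW w1] := leP (-1) w.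
  move: wu; rewrite le_eqVlt => /predU1P[->|/(mulr_expR_incr _ _ w1 w0)].
    by rewrite uE.
  by rewrite uE => /ltW.
move: vw; rewrite le_eqVlt => /predU1P[<-|vw]; first by rewrite vE.
by have := mulr_expR_decr _ _ vw w1; rewrite vE => /ltW.
Qed.

End Lambert.

(** * Envelope of the graphs over the confidence region *)

Section Band.
Context {R : realType}.
Variables (m n : nat) (c sh : R).
Hypotheses (m_gt0 : (0 < m)%N) (n_gt0 : (0 < n)%N) (sh_gt0 : 0 < sh).

(* [y |-> (m + 1) ln y - m y] is maximal at [y = (m + 1) / m]. *)
Definition cmax (k : nat) : R := k.+1%:R * (ln (k.+1%:R / k%:R) - 1).

Hypothesis c_le : c <= cmax m.

Let M_gt0 : 0 < m%:R :> R. Proof. by rewrite ltr0n. Qed.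
Let M1_gt0 : 0 < m.+1%:R :> R. Proof. by rewrite ltr0n. Qed.
Let n0 : 0 < n%:R :> R. Proof. by rewrite ltr0n. Qed.
Let wof (s : R) : R := - (m%:R * sh / m.+1%:R) / s.

Let wof_lt0 s : 0 < s -> wof s < 0.
Proof. by move=> s0; rewrite /wof mulNr oppr_lt0 !divr_gt0// mulr_gt0. Qed.

Lemma Warg_lt0 : Warg m c < 0.
Proof. by rewrite /Warg mulNr oppr_lt0 mulr_gt0 ?expR_gt0// divr_gt0. Qed.

(** Taking logarithms, this is exactly [c <= cmax m]: the bound on [c] places the argument in the
    domain of both branches. *)
Lemma Warg_ge : - expR (-1) <= Warg m c.
Proof.
rewrite /Warg mulNr lerN2.
have h : c / m.+1%:R <= ln (m.+1%:R / m%:R) - 1.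
  by rewrite ler_pdivrMr// mulrC.
have : expR (c / m.+1%:R) <= expR (ln (m.+1%:R / m%:R) - 1) by rewrite ler_expR.
rewrite expRD lnK ?posrE ?divr_gt0// => h2.
rewrite -ler_pdivlMl ?divr_gt0// (le_trans h2)// invf_div; exact: lexx.
Qed.

(** The factor [m / (m + 1)] occurs in both logarithms and cancels; what remains is
    [c / (m + 1) - ln (sh / s) - wof s]. *)
Let gfun_lambert s : 0 < s ->
  gfun m n c sh s = s * m.+1%:R / n%:R * (ln (- Warg m c) - ln (- (wof s * expR (wof s)))).
Proof.
move=> s0.
rewrite /Warg mulNr opprK lnM ?posrE ?expR_gt0 ?divr_gt0// expRK.
rewrite -mulNr (lnM (x := - wof s)) ?posrE ?expR_gt0 ?oppr_gt0 ?wof_lt0// expRK.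
have -> : - wof s = m%:R / m.+1%:R * (sh / s).
  by rewrite /wof; move: (m.+1%:R) M1_gt0 => N N0; field; rewrite !gt_eqF//.
rewrite [ln (_ * (sh / s))]lnM ?posrE ?divr_gt0// [ln (sh / s)]ln_div// /wof /gfun.
move: (m.+1%:R) M1_gt0 (ln _) => N N0 lN; field; rewrite !gt_eqF//.
Qed.

Let gfun_le0_w s : 0 < s -> (gfun m n c sh s <= 0) = (wof s * expR (wof s) <= Warg m c).
Proof.
move=> s0; rewrite gfun_lambert// pmulr_rle0 ?divr_gt0 ?mulr_gt0//.
rewrite subr_le0 ler_ln ?posrE ?oppr_gt0 ?Warg_lt0 ?lerN2//.
by rewrite nmulr_rlt0 ?expR_gt0 ?wof_lt0.
Qed.

Let K_gt0 : 0 < m%:R * sh / m.+1%:R :> R.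
Proof. by rewrite divr_gt0// mulr_gt0. Qed.

Lemma Zm1_gt0 : 0 < Zm1 m c sh.
Proof.
have [w1 _] := Wm1_spec _ Warg_ge Warg_lt0.
rewrite /Zm1 mulNr -mulrN -invrN mulr_gt0// invr_gt0 oppr_gt0.
by apply: le_lt_trans w1 _; rewrite oppr_lt0.
Qed.

Lemma Z0_gt0 : 0 < Z0 m c sh.
Proof.
have [_ w0 _] := W0_spec _ Warg_ge Warg_lt0.
by rewrite /Z0 mulNr -mulrN -invrN mulr_gt0// invr_gt0 oppr_gt0.
Qed.

(** The map [wof] is increasing on positive scales and sends [Zm1] and [Z0] to the values of the
    branches [Wm1] and [W0]. *)
Lemma gfun_le0 s : 0 < s ->
  (gfun m n c sh s <= 0) = (Zm1 m c sh <= s <= Z0 m c sh).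
Proof.
move=> s0; rewrite gfun_le0_w//.
rewrite mulr_expR_le ?Warg_ge ?Warg_lt0 ?wof_lt0//.
have [w1 _] := Wm1_spec _ Warg_ge Warg_lt0.
have [_ u0 _] := W0_spec _ Warg_ge Warg_lt0.
have w0 : Wm1 (Warg m c) < 0 by apply: le_lt_trans w1 _; rewrite oppr_lt0.
rewrite /Zm1 /Z0 /wof !mulNr; congr (_ && _).
  rewrite -[in RHS]mulrN -invrN ler_pdivrMr ?oppr_gt0// lerNr ler_pdivrMr//.
  by rewrite [_ * s]mulrC.
rewrite -[in RHS]mulrN -invrN ler_pdivlMr ?oppr_gt0// lerNl ler_pdivlMr//.
by rewrite [_ * s]mulrC.
Qed.

Let gfun_eq0 s : 0 < s -> wof s * expR (wof s) = Warg m c -> gfun m n c sh s = 0.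
Proof. by move=> s0 h; rewrite gfun_lambert// h subrr mulr0. Qed.

Lemma gfun_Z0 : gfun m n c sh (Z0 m c sh) = 0.
Proof.
have [_ u0 uE] := W0_spec _ Warg_ge Warg_lt0.
apply: gfun_eq0; first exact: Z0_gt0.
suff -> : wof (Z0 m c sh) = W0 (Warg m c) by [].
rewrite /wof /Z0.
by rewrite invf_div mulrC divfK// oppr_eq0 gt_eqF.
Qed.

Lemma gfun_Zm1 : gfun m n c sh (Zm1 m c sh) = 0.
Proof.
have [w1 wE] := Wm1_spec _ Warg_ge Warg_lt0.
apply: gfun_eq0; first exact: Zm1_gt0.
suff -> : wof (Zm1 m c sh) = Wm1 (Warg m c) by [].
have w0 : Wm1 (Warg m c) < 0 by apply: le_lt_trans w1 _; rewrite oppr_lt0.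
rewrite /wof /Zm1.
by rewrite invf_div mulrC divfK// oppr_eq0 gt_eqF.
Qed.

Lemma Zm1_le_Z0 : Zm1 m c sh <= Z0 m c sh.
Proof. by have := gfun_le0 _ Zm1_gt0; rewrite gfun_Zm1 lexx => /esym/andP[]. Qed.

(** For fixed [s] the defining inequality is affine in [mu]; multiplying by [s / n] solves it for
    [mu]. *)
Lemma C3E a mu s : C3 m n c a sh mu s <->
  [/\ 0 < s, a + gfun m n c sh s <= mu & mu <= a].
Proof.
suff h : 0 < s -> (c <= m.+1%:R * ln (sh / s) - (n%:R * (a - mu) + m%:R * sh) / s)
    = (a + gfun m n c sh s <= mu).
  by split=> [[? s0]|[s0]]; [rewrite h//|rewrite -h//].
move=> s0; rewrite ln_div ?posrE// -subr_ge0 -[RHS]subr_ge0.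
rewrite -[in RHS](pmulr_rge0 _ (divr_gt0 n0 s0)) /gfun; congr (0 <= _).
move: (m.+1%:R) M1_gt0 => N N0; field; rewrite !gt_eqF//.
Qed.

(** In this form the cdf is a monotone continuous function of the standardized abscissa alone, which
    serves for comparing graphs, inverting them and proving continuity. *)
Lemma FexpE (mu s x : R) : 0 < s -> Fexp mu s x = 1 - expR (- Num.max 0 ((x - mu) / s)).
Proof.
move=> s0; rewrite /Fexp; case: leP => h.
  by rewrite max_l ?oppr0 ?expR0 ?subrr// pmulr_lle0 ?invr_gt0// subr_le0.
by rewrite max_r// ltW// divr_gt0// subr_gt0.
Qed.

Lemma Fexp_ge0 (mu s x : R) : 0 < s -> 0 <= Fexp mu s x.
Proof. by move=> s0; rewrite FexpE// subr_ge0 expR_le1 oppr_le0 le_max lexx. Qed.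

Lemma Fexp_lt1 (mu s x : R) : Fexp mu s x < 1.
Proof. by rewrite /Fexp; case: ifP => // _; rewrite ltrBlDr ltrDl expR_gt0. Qed.

Lemma ler_Fexp (mu s mu' s' x : R) : 0 < s -> 0 < s' -> (x - mu) / s <= (x - mu') / s' ->
  Fexp mu s x <= Fexp mu' s' x.
Proof.
move=> s0 s0' h; rewrite !FexpE// lerB// ler_expR lerN2.
by rewrite ge_max !le_max lexx h orbT.
Qed.

Variable a : R.
Let sstar x := Num.max (Zm1 m c sh) (Num.min (Z0 m c sh) (sigstar m n a sh x)).

Let sstar_ge x : Zm1 m c sh <= sstar x.
Proof. by rewrite le_max lexx. Qed.
Let sstar_le x : sstar x <= Z0 m c sh.
Proof. by rewrite ge_max Zm1_le_Z0 ge_min lexx. Qed.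
Let sstar_gt0 x : 0 < sstar x.
Proof. exact: lt_le_trans Zm1_gt0 (sstar_ge x). Qed.

(** The three cases merge because [gfun] vanishes at [Zm1] and [Z0], so that clamping the scale
    there gives location [a]. *)
Lemma O3E x : O3 m n c a sh x =
  let s := Num.max (Zm1 m c sh) (Num.min (Z0 m c sh) (sigstar m n a sh x)) in
  Fexp (a + gfun m n c sh s) s x.
Proof.
rewrite /O3 /=; set s := sigstar _ _ _ _ _; have := Zm1_le_Z0.
case: ltP => [h1 h|h1 h].
  have -> : Num.max (Zm1 m c sh) (Num.min (Z0 m c sh) s) = Zm1 m c sh.
    by rewrite max_l// ge_min (ltW h1) orbT.
  by rewrite gfun_Zm1 addr0.
case: leP => h2; first by rewrite max_r.
by rewrite max_r// gfun_Z0 addr0.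
Qed.

Lemma le_sstar x s : Zm1 m c sh <= s <= Z0 m c sh ->
  (x - (a + gfun m n c sh s)) / s <= (x - (a + gfun m n c sh (sstar x))) / sstar x.
Proof.
move=> /andP[s1 s2]; have s0 : 0 < s := lt_le_trans Zm1_gt0 s1.
set t := sstar x; have t0 : 0 < t := sstar_gt0 x.
set q := sigstar m n a sh x.
(* Only [q / r + ln r] depends on [r], so it remains to minimize this expression. *)
have E r : 0 < r -> (x - (a + gfun m n c sh r)) / r =
    - (m.+1%:R / n%:R) * (q / r + ln r + (c / m.+1%:R - ln sh)).
  by move=> r0; rewrite /q /sigstar /gfun; move: (m.+1%:R) M1_gt0 => N N0; field; rewrite !gt_eqF//.
rewrite !E// !mulNr lerN2 ler_pM2l ?divr_gt0// lerD2r.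
have L : ln t - ln s <= t / s - 1.
  rewrite -ln_div ?posrE//.
  have := @le_ln1Dx R (t / s - 1); rewrite addrCA subrr addr0; apply.
  by rewrite ltrBrDl addrN divr_gt0.
(* Projection inequality: [t] is the point of [[Zm1, Z0]] nearest to [q], hence
   [(q - t) * (t - s) >= 0] for every [s] in that interval. *)
have Q : (q - t) * (s^-1 - t^-1) >= 0.
  have i : s^-1 - t^-1 = (t - s) / (s * t) by field; rewrite !gt_eqF//.
  rewrite i mulrA; apply: divr_ge0; last by rewrite ltW// mulr_gt0.
  rewrite /t /sstar -/q; have := Zm1_le_Z0.
  case: (leP (Z0 m c sh) q) => h1 h2.
    by rewrite max_r// mulr_ge0// subr_ge0.
  case: (leP (Zm1 m c sh) q) => h3; first by rewrite subrr mul0r.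
  by rewrite mulr_le0// subr_le0// ltW.
have e : q / s - q / t = (q - t) * (s^-1 - t^-1) + (t / s - 1).
  by field; rewrite !gt_eqF//.
move: L Q e; set A := q / s; set B := q / t; set D := t / s; set G := (q - t) * _.
lra.
Qed.

(** One inclusion is the optimality of the two bounding curves. For the other, a member of [C3] is
    exhibited whose graph passes through the given point. *)
Lemma B3E : B3 m n c a sh = [set xy : R * R | 0 <= xy.2 <= 1 /\
  U3 m c a sh xy.1 <= xy.2 <= O3 m n c a sh xy.1].
Proof.
apply/seteqP; split => -[x y] /=.
  move=> [mu [s [/C3E[s0 mu1 mu2]]]]; rewrite /graph /= => ->.
  rewrite Fexp_ge0// (ltW (Fexp_lt1 _ _ _)) O3E.
  have sZ : Zm1 m c sh <= s <= Z0 m c sh.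
    by rewrite -gfun_le0//; lra.
  split => //; apply/andP; split.
    have [xa|xa] := leP x a; first by rewrite /U3 /Fexp xa; exact: Fexp_ge0.
    apply: ler_Fexp => //; first exact: Z0_gt0.
    (* The scale is changed first, while the numerator is the positive number [x - a], and the
       location afterwards. *)
    apply: (@le_trans _ _ ((x - a) / s)).
      rewrite ler_pM2l ?subr_gt0// lef_pV2 ?posrE ?Z0_gt0//; by case/andP: sZ.
    by rewrite ler_pM2r ?invr_gt0// lerB.
  apply: ler_Fexp => //; first exact: sstar_gt0.
  apply: le_trans (le_sstar _ _ sZ).
  by rewrite ler_pM2r ?invr_gt0// lerB.
move=> [/andP[y0 y1]]; rewrite O3E /U3 /=.
set s := Num.max _ _; rewrite -/(sstar x) in s *; have t0 := sstar_gt0 x.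
rewrite -/(sstar x) in t0; move: (sstar_le x) (sstar_ge x).
rewrite -/s in t0 *; move=> sZ0 sZm /andP[yU yO].
have y1' : y < 1 by apply: le_lt_trans yO (Fexp_lt1 _ _ _).
(* The standard exponential quantile of [y], finite because [O3 < 1]; a graph passes through the
   point iff its standardized abscissa, cut off at 0, equals [v]. *)
pose v := - ln (1 - y).
have yE : y = 1 - expR (- v).
  by rewrite /v opprK lnK ?posrE ?subr_gt0// opprB addrC subrK.
have v0 : 0 <= v by rewrite oppr_ge0 ln_le0//; lra.
have Fv mu r : 0 < r -> (Fexp mu r x <= y) = (Num.max 0 ((x - mu) / r) <= v).
  by move=> r0; rewrite FexpE// yE lerD2l lerN2 ler_expR lerN2.
have vF mu r : 0 < r -> (y <= Fexp mu r x) = (v <= Num.max 0 ((x - mu) / r)).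
  by move=> r0; rewrite FexpE// yE lerD2l lerN2 ler_expR lerN2.
have vE mu r : 0 < r -> v = Num.max 0 ((x - mu) / r) -> y = Fexp mu r x.
  by move=> r0 h; rewrite FexpE// yE h.
move: yU; rewrite Fv ?Z0_gt0// => yU; move: yO; rewrite vF// => yO.
have [v00|vp] : v = 0 \/ 0 < v by move: v0; rewrite le_eqVlt => /predU1P[]; auto.
  exists a, (Z0 m c sh); split; last first.
    apply: vE; first exact: Z0_gt0.
    by apply/eqP; rewrite eq_le yU v00 le_max lexx.
  by apply/C3E; rewrite Z0_gt0 gfun_Z0 addr0 lexx.
(* If the graph with location [a] and scale [s] is high enough, keep the location and enlarge the
   scale to [(x - a) / v], which stays between [s] and [Z0]. *)
have [h|h] := leP v ((x - a) / s).
  have xa : 0 < x - a by rewrite -(pmulr_lgt0 (x - a) (_ : 0 < s^-1)) ?invr_gt0//; exact: lt_le_trans vp h.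
  exists a, ((x - a) / v); split; last first.
    apply: vE; first exact: divr_gt0.
    rewrite max_r; last by rewrite invf_div mulrC divfK ?gt_eqF// ltW.
    by rewrite invf_div mulrC divfK ?gt_eqF.
  have r0 : 0 < (x - a) / v by exact: divr_gt0.
  apply/C3E; split => //; rewrite gerDl gfun_le0//.
  apply/andP; split.
    apply: (le_trans sZm); rewrite ler_pdivlMr// mulrC -ler_pdivlMr//.
  rewrite ler_pdivrMr// mulrC -ler_pdivrMr ?Z0_gt0//.
  by apply: le_trans yU; rewrite le_max lexx orbT.
(* Otherwise keep the optimal scale and move the location, which lands between [a + gfun s] and
   [a]. *)
exists (x - v * s), s; split; last first.
  by apply: vE => //; rewrite subKr mulfK ?gt_eqF// max_r.
apply/C3E; split => //; last by rewrite lerBlDr -lerBlDl ltW// -ltr_pdivrMr.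
move: yO; rewrite le_max leNgt vp/= ler_pdivlMr//; lra.
Qed.

End Band.

(** * Gamma convolutions *)

Section Integrals.
Context {R : realType}.
Notation lambda := (@lebesgue_measure R).
Local Open Scope ereal_scope.

(** The pushforward of Lebesgue measure under the affine map, scaled by [b], has the right value on
    half-open intervals, hence is Lebesgue measure by uniqueness. *)
Lemma ge0_integral_affine (a b : R) (f : R -> \bar R) : (0 < b)%R ->
  measurable_fun [set: R] f -> (forall x, 0 <= f x) ->
  \int[lambda]_x f (b * (x - a))%R = b^-1%:E * \int[lambda]_x f x.
Proof.
move=> b0 mf f0.
pose phi := (fun x => b * (x - a))%R : measurableTypeR R -> measurableTypeR R.
have mphi : measurable_fun setT phi.
  by apply: measurable_funM => //; exact: measurable_funB.
pose b' : {nonneg R} := NngNum (ltW b0).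
pose pw : {measure set (measurableTypeR R) -> \bar R} :=
  pushforward lambda phi.
pose nu : {measure set (measurableTypeR R) -> \bar R} := mscale b' (pw mphi).
have lnu : forall A, measurable A -> lambda A = nu A.
  apply: lebesgue_measure_unique => _ [[u v]] _ <-.
  rewrite [RHS](_ : _ = b%:E * lambda (phi @^-1` `]u, v])) //=.
  have -> : phi @^-1` `]u, v] = `](a + u / b)%R, (a + v / b)%R]%classic.
    apply/seteqP; split => x /=; rewrite /phi !in_itv /= => /andP[h1 h2].
      by rewrite -ltrBDl -lerBDl ltr_pdivrMr// ler_pdivlMr// mulrC h1.
    move: h1 h2; rewrite -ltrBDl -lerBDl ltr_pdivrMr// ler_pdivlMr// mulrC.
    by move=> -> ->.
  rewrite !lebesgue_measure_itv /= !lte_fin ltrD2l ltr_pM2r ?invr_gt0//.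
  case: ifP => _; last by rewrite mule0.
  rewrite -!EFinB -EFinM; congr EFin.
  by field; rewrite gt_eqF.
have -> : \int[lambda]_x f x = \int[nu]_x f x.
  by apply: eq_measure_integral => A mA _; exact: lnu.
rewrite /nu ge0_integral_mscale//= /pw ge0_integral_pushforward//=.
by rewrite muleA -EFinM mulVf ?gt_eqF// mul1e.
Qed.

Lemma measurable_gamma_pdf k (b : R) : measurable_fun setT (gamma_pdf k b).
Proof.
apply: measurable_fun_ifT => //; first exact: measurable_fun_ltr.
apply: measurable_funM => //; apply: measurable_funM; first exact: exprn_measurable.
by apply: measurableT_comp => //; apply: measurableT_comp => //; exact: measurable_funM.
Qed.

Lemma gamma_pdf_ge0 k (b y : R) : (0 <= b)%R -> (0 <= gamma_pdf k b y)%R.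
Proof.
move=> b0; rewrite /gamma_pdf; case: ifP => // y0.
by rewrite divr_ge0 ?mulr_ge0 ?exprn_ge0 ?expR_ge0 // ltW.
Qed.

Lemma fexp01 (z : R) : fexp 0 1 z = gamma_pdf 1 1 z.
Proof.
rewrite /fexp /gamma_pdf; case: leP => // z0.
by rewrite subr0 invr1 expr0 !mul1r expr1 mulr1 divr1.
Qed.

Lemma gamma_pdf_scale k (b y : R) : (0 < b)%R -> (0 < k)%N ->
  gamma_pdf k b^-1 y = (b * gamma_pdf k 1 (b * y))%R.
Proof.
move=> b0 k0; rewrite /gamma_pdf pmulr_rgt0//; case: ifP => _; last by rewrite mulr0.
rewrite !divr1 invrK [(y * b)%R]mulrC expr1n mulr1 exprMn exprVn invfM invrK.
by case: k k0 => // k _; rewrite exprS /=; ring.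
Qed.

(* The Beta(k, 1) integral behind [Gamma(1) * Gamma(k) = Gamma(k + 1)]. *)
Lemma gamma_pdf_conv k (t : R) : (0 < k)%N ->
  \int[lambda]_z (gamma_pdf k 1 (t - z) * gamma_pdf 1 1 z)%:E = (gamma_pdf k.+1 1 t)%:E.
Proof.
case: k => // k _.
pose c := (expR (- t) / k`!%:R)%R.
(* The exponentials combine to [expR (- t)], which is free of [z], so a polynomial on []0, t[] is
   left. *)
have E z : (gamma_pdf k.+1 1 (t - z) * gamma_pdf 1 1 z)%:E =
    ((fun z => ((t - z) ^+ k * c)%:E) \_ `]0%R, t[) z.
  rewrite patchE mem_setE in_itv /= /gamma_pdf subr_gt0.
  case: (ltP 0%R z) => z0 /=; last by rewrite mulr0.
  case: ifP => zt; last by rewrite mul0r.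
  rewrite !expr1n fact0 !mulr1 !divr1 expr0 mul1r /c.
  have -> : (- t = - (t - z) + - z)%R by ring.
  by rewrite expRD; congr EFin; field; rewrite pnatr_eq0 -lt0n fact_gt0.
under eq_integral do rewrite E.
rewrite -integral_mkcond /gamma_pdf.
case: ltP => t0; last first.
  by rewrite set_itv_ge ?integral_set0// bnd_simp -leNgt.
pose F z := (- ((t - z) ^+ k.+1 * (c / k.+1%:R)))%R.
have k1 : (k.+1%:R != 0 :> R)%R by rewrite pnatr_eq0.
have dF (z : R) : is_derive z (1:R)%R F ((t - z) ^+ k * c)%R.
  have -> : F = (- ((cst t - id) ^+ k.+1 * cst (c / k.+1%:R)) : R -> R)%R.
    by apply/funext => u; rewrite /F !fctE.
  apply: is_derive_eq.
  rewrite /GRing.scale/= mulr0 add0r sub0r; rewrite fctE /=.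
  by move: (k.+1%:R) k1 => K K0; field.
have cF : continuous F.
  move=> z; apply: differentiable_continuous; apply/derivable1_diffP.
  by have [] := dF z.
have cf : continuous (fun z => (t - z) ^+ k * c)%R.
  move=> z; apply: cvgM; last exact: cvg_cst.
  apply: (@continuous_comp _ _ _ (fun z => t - z)%R (fun z => z ^+ k)%R).
    by apply: cvgB; [exact: cvg_cst|exact: cvg_id].
  exact: exprn_continuous.
have mf : measurable_fun [set: R] (fun z : R => ((t - z) ^+ k * c)%:E).
  by apply/measurable_EFinP; exact: continuous_measurable_fun.
rewrite integral_itv_bndo_bndc; last exact: measurable_funTS.
rewrite integral_itv_obnd_cbnd; last exact: measurable_funTS.
rewrite (continuous_FTC2 t0 (F := F)).
- have -> : F t = 0%R by rewrite /F subrr expr0n /= mul0r oppr0.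
  have -> : F 0%R = (- (t ^+ k.+1 * (c / k.+1%:R)))%R by rewrite /F subr0.
  rewrite -EFinB sub0r opprK /c /= factS natrM expr1n mulr1 divr1; congr EFin.
  by rewrite [(k.+1%:R * _)%R]mulrC invfM !mulrA.
- exact: continuous_subspaceT.
- split.
  + by move=> z _; have [] := dF z.
  + by apply: cvg_at_right_filter; exact: cF.
  + by apply: cvg_at_left_filter; exact: cF.
- by move=> z _; rewrite derive1E; exact: derive_val.
Qed.

(** Substitute [t = z + y] in the inner integral, then exchange the integrals by Tonelli. *)
Lemma integral_conv (phi f g : R -> R) :
  measurable_fun [set: R] phi -> measurable_fun [set: R] f ->
  measurable_fun [set: R] g ->
  (forall y, 0 <= phi y)%R -> (forall y, 0 <= f y)%R -> (forall y, 0 <= g y)%R ->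
  \int[lambda]_z ((f z)%:E * \int[lambda]_y (phi (z + y) * g y)%:E) =
  \int[lambda]_t ((phi t)%:E * \int[lambda]_z (g (t - z) * f z)%:E).
Proof.
move=> mphi mf mg phi0 f0 g0.
have mB (z : R) : measurable_fun [set: R] (fun t : R => (t - z)%R).
  exact: measurable_funB.
have mB' (t : R) : measurable_fun [set: R] (fun z : R => (t - z)%R).
  exact: measurable_funB.
transitivity (\int[lambda]_z \int[lambda]_t (f z * (phi t * g (t - z)))%:E).
  apply: eq_integral => z _.
  have mh : measurable_fun [set: R] (fun t => (phi t * g (t - z))%:E).
    apply/measurable_EFinP; apply: measurable_funM; first exact: mphi.
    exact: measurableT_comp mg (mB z).
  have h0 t : 0 <= (phi t * g (t - z))%:E by rewrite lee_fin mulr_ge0.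
  have := @ge0_integral_affine (- z)%R 1 _ ltr01 mh h0.
  rewrite invr1 mul1e => h.
  under [in RHS]eq_integral do rewrite EFinM.
  rewrite ge0_integralZl_EFin; [|exact: measurableT|by move=> t _|exact: mh|exact: f0].
  congr (_ * _); rewrite -h.
  apply: eq_integral => y _; rewrite mul1r opprK (addrC y).
  by rewrite [(z + y - z)%R]addrAC subrr add0r.
pose K (zt : R * R) := (f zt.1 * (phi zt.2 * g (zt.2 - zt.1)))%:E.
have mK : measurable_fun [set: R * R] K.
  apply/measurable_EFinP; apply: measurable_funM.
    exact: measurableT_comp mf measurable_fst.
  apply: measurable_funM; first exact: measurableT_comp mphi measurable_snd.
  by apply: (measurableT_comp mg); exact: measurable_funB.
have K0 zt : 0 <= K zt by rewrite lee_fin !mulr_ge0.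
rewrite (fubini_tonelli (m1 := lambda) (m2 := lambda) K mK K0).
apply: eq_integral => t _; rewrite /K /=.
under eq_integral do rewrite mulrCA [(f _ * _)%R]mulrC EFinM.
rewrite ge0_integralZl_EFin //.
- by move=> z _; rewrite lee_fin mulr_ge0.
- apply/measurable_EFinP; apply: measurable_funM; last exact: mf.
  exact: measurableT_comp mg (mB' t).
Qed.

(** An Exp(1) variable plus an independent Gamma(k, 1) variable is Gamma(k + 1, 1), tested against
    [phi]; this adds one normalized spacing. *)
Lemma gamma_pdf_convolution k (phi : R -> R) : (0 < k)%N ->
  measurable_fun [set: R] phi -> (forall y, 0 <= phi y)%R ->
  \int[lambda]_z ((gamma_pdf 1 1 z)%:E *
     \int[lambda]_y (phi (z + y) * gamma_pdf k 1 y)%:E) =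
  \int[lambda]_t (phi t * gamma_pdf k.+1 1 t)%:E.
Proof.
move=> k0 mphi phi0; rewrite integral_conv//.
- by apply: eq_integral => t _; rewrite gamma_pdf_conv.
- exact: measurable_gamma_pdf.
- exact: measurable_gamma_pdf.
- by move=> y; exact: gamma_pdf_ge0.
- by move=> y; exact: gamma_pdf_ge0.
Qed.

(** Integrates out one order statistic whose normalized distance from [a] is standard exponential.
    The value at the null point [a] is left free, because the densities involved follow different
    conventions there. *)
Lemma integral_exp_shift (h G : R -> \bar R) (a b : R) : (0 < b)%R ->
  measurable_fun [set: R] G -> (forall z, 0 <= G z) ->
  (forall x, (x < a)%R -> h x = 0) ->
  (forall x, (a < x)%R -> h x = (b * expR (- (b * (x - a))))%:E * G (b * (x - a))%R) ->
  \int[lambda]_x h x = \int[lambda]_z ((gamma_pdf 1 1 z)%:E * G z).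
Proof.
move=> b0 mG G0 h1 h2.
pose f z := (gamma_pdf 1 1 z)%:E * G z.
have mf : measurable_fun [set: R] f.
  by apply: emeasurable_funM; [apply/measurable_EFinP; exact: measurable_gamma_pdf|].
have f0 z : 0 <= f z by rewrite mule_ge0// lee_fin gamma_pdf_ge0.
have mf' : measurable_fun [set: R] (fun x : R => f (b * (x - a))%R).
  apply: (measurableT_comp mf); apply: measurable_funM; first exact: measurable_cst.
  exact: measurable_funB.
have hE x : x != a -> h x = b%:E * f (b * (x - a))%R.
  rewrite neq_lt => /orP[xa|xa].
    rewrite h1// /f /gamma_pdf ltNge ltW ?mul0e ?mule0//.
    by rewrite pmulr_rlt0// subr_lt0.
  rewrite h2// /f /gamma_pdf pmulr_rgt0// subr_gt0 xa expr0 mul1r fact0 expr1.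
  by rewrite mulr1 !divr1 muleA -EFinM.
have -> : \int[lambda]_x h x = \int[lambda]_x (b%:E * f (b * (x - a))%R).
  (* Measurability of [h] is not assumed; it follows from this description. *)
  have hE' : h = fun x => if x == a then h a else b%:E * f (b * (x - a))%R.
    by apply/funext => x; case: eqP => [->//|/eqP/hE].
  apply: ae_eq_integral => //.
  - rewrite hE'; apply: measurable_fun_ifT => //.
      by apply: measurable_fun_eqr.
    exact: emeasurable_funM.
  - exact: emeasurable_funM.
  - exists [set a]; split => //; first exact: lebesgue_measure_set1.
    move=> x /= /not_implyP[_ xE]; apply/eqP/negPn/negP => /hE.
    exact: xE.
rewrite ge0_integralZl_EFin// ?ltW// ge0_integral_affine// muleA -EFinM.
by rewrite divff ?gt_eqF// mul1e.
Qed.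

End Integrals.

(** * Spacings of censored order statistics *)

Section Spacings.
Context {R : realType}.
Notation lambda := (@lebesgue_measure R).
Implicit Types (cs : nat -> nat) (mu sigma a x : R) (t : seq R).

Definition pcos_factor k cs mu sigma j x : R :=
  (gam k cs j)%:R * fexp mu sigma x * (1 - Fexp mu sigma x) ^+ cs j.

(* Conditional density of the remaining [k] order statistics given that the
   previous one equals [a], up to normalization. *)
Definition pcos_tail k cs mu sigma a t : R :=
  if path <=%R a t then \prod_(j < k) pcos_factor k cs mu sigma j t`_j else 0.

(** The total time on test after [a], i.e. the sum of the normalized spacings; entry [j] of [a :: t]
    is the predecessor of entry [j] of [t]. *)
Definition total_time k cs a t : R :=
  \sum_(j < k) (gam k cs j)%:R * (t`_j - (a :: t)`_j).

Lemma gamS k cs j : gam k.+1 cs j.+1 = gam k (cs \o succn) j.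
Proof. by rewrite /gam big_add1. Qed.

Lemma gam_recl k cs : gam k.+1 cs 0 = ((cs 0).+1 + gam k (cs \o succn) 0)%N.
Proof. by rewrite /gam big_nat_recl. Qed.

Lemma pcos_factorS k cs mu sigma j x :
  pcos_factor k.+1 cs mu sigma j.+1 x = pcos_factor k (cs \o succn) mu sigma j x.
Proof. by rewrite /pcos_factor gamS. Qed.

Lemma pcos_tail_cons k cs mu sigma a x t :
  pcos_tail k.+1 cs mu sigma a (x :: t) =
  (if a <= x then pcos_factor k.+1 cs mu sigma 0 x else 0) *
  pcos_tail k (cs \o succn) mu sigma x t.
Proof.
rewrite /pcos_tail /=; case: leP => _ /=; last by rewrite mul0r.
case: ifP => _; last by rewrite mulr0.
by rewrite big_ord_recl; congr (_ * _); apply: eq_bigr => j _; rewrite -pcos_factorS.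
Qed.

Lemma total_time_cons k cs a x t :
  total_time k.+1 cs a (x :: t) =
  (gam k.+1 cs 0)%:R * (x - a) + total_time k (cs \o succn) x t.
Proof.
rewrite /total_time big_ord_recl; congr (_ + _).
by apply: eq_bigr => j _; rewrite -gamS.
Qed.

Lemma pcos_density_cons k cs mu sigma x (t : k.-tuple R) :
  pcos_density k.+1 cs mu sigma (cons_tuple x t) =
  pcos_factor k.+1 cs mu sigma 0 x * pcos_tail k (cs \o succn) mu sigma x t.
Proof.
have -> : pcos_density k.+1 cs mu sigma (cons_tuple x t) =
    if sorted <=%R (x :: t) then
      \prod_(j < k.+1) pcos_factor k.+1 cs mu sigma j (x :: t)`_j else 0.
  rewrite /pcos_density.
  (* The density compares all pairs of indices, [sorted] only neighbours; transitivity of the order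
     makes them agree. *)
  have -> : [forall i : 'I_k.+1, forall j : 'I_k.+1, (i <= j)%N ==>
      (tnth (cons_tuple x t) i <= tnth (cons_tuple x t) j)] = sorted <=%R (x :: t).
    apply/idP/idP => [/forallP h|].
      apply/(sortedP 0) => i; rewrite [size _]/= size_tuple => ik.
      have := forallP (h (Ordinal (ltnW ik))) (Ordinal ik).
      by rewrite /= leqnSn !(tnth_nth 0).
    move=> s; apply/forallP => i; apply/forallP => j; apply/implyP => ij.
    rewrite !(tnth_nth 0); apply: (le_sorted_leq_nth 0 s) => //;
      by rewrite inE /= size_tuple ltn_ord.
  by case: ifP => // _; apply: eq_bigr => j _; rewrite (tnth_nth 0).
rewrite /pcos_tail /=; case: ifP => _; last by rewrite mulr0.
by rewrite big_ord_recl; congr (_ * _); apply: eq_bigr => j _; rewrite -pcos_factorS.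
Qed.

Lemma sighat_cons k cs x (t : k.-tuple R) :
  sighat k.+1 cs (cons_tuple x t) = k.+1%:R^-1 * total_time k (cs \o succn) x t.
Proof.
rewrite /sighat /total_time big_add1 /= big_mkord; congr (_ * _).
by apply: eq_bigr => j _; rewrite gamS.
Qed.

(** The exponents count the failing unit, the units censored with it and those still on test.
    Together these are [gam k.+1 cs 0] units, whose minimum is exponential with that rate over
    [sigma]. *)
Lemma pcos_factorE k cs mu sigma x : 0 < sigma -> mu < x ->
  pcos_factor k.+1 cs mu sigma 0 x *
    expR (- ((gam k (cs \o succn) 0)%:R * (x - mu) / sigma)) =
  (gam k.+1 cs 0)%:R / sigma * expR (- ((gam k.+1 cs 0)%:R * (x - mu) / sigma)).
Proof.
move=> s0 xmu; rewrite /pcos_factor /fexp /Fexp leNgt xmu /=.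
rewrite subKr -expRM_natl -!mulrA; do 2 congr (_ * _).
rewrite mulrA -!expRD; congr expR; rewrite gam_recl natrD -[(cs 0%N).+1]addn1 natrD.
by field; rewrite gt_eqF.
Qed.

Lemma pcos_factor_ge0 k cs mu sigma j x : 0 < sigma -> 0 <= pcos_factor k cs mu sigma j x.
Proof.
move=> s0; rewrite /pcos_factor /fexp /Fexp; case: (leP x mu) => _.
  by rewrite mulr0 mul0r.
rewrite !mulr_ge0 ?exprn_ge0 ?expR_ge0 ?invr_ge0 ?(ltW s0)//.
Qed.

Lemma iter_integralS k (f : k.+1.-tuple R -> \bar R) :
  iter_integral f =
  (\int[lambda]_x iter_integral (fun t : k.-tuple R => f (cons_tuple x t)))%E.
Proof. by []. Qed.

Lemma iter_integral0 k : iter_integral (fun _ : k.-tuple R => 0%E) = 0%E.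
Proof.
by elim: k => //= k IH; under eq_integral do rewrite IH; exact: integral0.
Qed.

Lemma gam_gt0 k cs : (0 < gam k.+1 cs 0)%N.
Proof. by rewrite gam_recl. Qed.

(** Induction from the last order statistic inwards. The factor in front of [phi] is the probability
    that all units still on test survive [a]; [pcos_factorE] absorbs it into the density of the
    preceding order statistic. *)
Lemma iter_integral_total_time k cs mu sigma a (phi : R -> R) :
  0 < sigma -> mu <= a -> measurable_fun [set: R] phi -> (forall y, 0 <= phi y) ->
  iter_integral (fun t : k.+1.-tuple R =>
    (phi (total_time k.+1 cs a t / sigma) * pcos_tail k.+1 cs mu sigma a t)%:E) =
  (\int[lambda]_y (expR (- ((gam k.+1 cs 0)%:R * (a - mu) / sigma)) * phi y *
                    gamma_pdf k.+1 1 y)%:E)%E.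
Proof.
move=> s0; elim: k => [|k IH] in cs a phi * => mua mphi phi0.
  set C := expR _; set g : R := (gam 1 cs 0)%:R.
  have g0 : 0 < g by rewrite ltr0n gam_gt0.
  rewrite /=; rewrite (@integral_exp_shift _ _ (fun z => (C * phi z)%:E) a (g / sigma)).
  - by apply: eq_integral => z _; rewrite -EFinM mulrC.
  - by rewrite divr_gt0.
  - by apply/measurable_EFinP; exact: measurable_funM.
  - by move=> z; rewrite lee_fin mulr_ge0 ?expR_ge0.
  - by move=> x xa; rewrite pcos_tail_cons leNgt xa /= mul0r mulr0.
  - move=> x ax; rewrite pcos_tail_cons total_time_cons (ltW ax).
    have := @pcos_factorE 0 cs mu sigma x s0 (le_lt_trans mua ax).
    (* No unit remains after the last failure, so the survival factor is 1. *)
    rewrite /gam big_geq// mul0r mul0r oppr0 expR0 mulr1 => ->.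
    rewrite /pcos_tail /total_time !big_ord0 addr0 mulr1 -/(gam 1 cs 0) -/g -EFinM.
    have -> : g * (x - a) / sigma = g / sigma * (x - a) by rewrite mulrAC.
    have -> : expR (- (g * (x - mu) / sigma)) = C * expR (- (g / sigma * (x - a))).
      by rewrite /C -expRD; congr expR; rewrite -/g; field; rewrite gt_eqF.
    by congr EFin; ring.
set C := expR _; set g : R := (gam k.+2 cs 0)%:R.
have g0 : 0 < g by rewrite ltr0n gam_gt0.
pose G z := (\int[lambda]_y (C * phi (z + y) * gamma_pdf k.+1 1 y)%:E)%E.
have G0 z : (0 <= G z)%E.
  apply: integral_ge0 => y _; rewrite lee_fin !mulr_ge0 ?expR_ge0//.
  exact: gamma_pdf_ge0.
have mG : measurable_fun [set: R] G.
  pose K (zy : R * R) := (C * phi (zy.1 + zy.2) * gamma_pdf k.+1 1 zy.2)%:E.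
  have mK : measurable_fun [set: R * R] K.
    apply/measurable_EFinP; apply: measurable_funM.
      apply: measurable_funM; first exact: measurable_cst.
      by apply: (measurableT_comp mphi); exact: measurable_funD.
    exact: measurableT_comp (measurable_gamma_pdf _ _) measurable_snd.
  apply: (measurable_fun_fubini_tonelli_F (m2 := lambda) K mK) => -[z y].
  rewrite lee_fin !mulr_ge0 ?expR_ge0//; exact: gamma_pdf_ge0.
rewrite -(@gamma_pdf_convolution _ k.+1 (fun y => C * phi y))//; last 2 first.
- by apply: measurable_funM => //; exact: measurable_cst.
- by move=> y; rewrite mulr_ge0 ?expR_ge0.
rewrite iter_integralS; apply: (@integral_exp_shift _ _ G a (g / sigma)) => //.
- by rewrite divr_gt0.
- move=> x xa; rewrite -[RHS](iter_integral0 k.+1).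
  congr (iter_integral _); apply/funext => t.
  by rewrite pcos_tail_cons leNgt xa /= mul0r mulr0.
(* The induction hypothesis is applied to a test function that carries the density factor of [x] and
   is shifted by the first normalized spacing. *)
move=> x ax; pose psi y := pcos_factor k.+2 cs mu sigma 0 x * phi (g / sigma * (x - a) + y).
have mpsi : measurable_fun [set: R] psi.
  apply: measurable_funM; first exact: measurable_cst.
  by apply: (measurableT_comp mphi); apply: measurable_funD.
have psi0 y : 0 <= psi y by rewrite mulr_ge0// pcos_factor_ge0.
have xmu : mu < x by exact: le_lt_trans ax.
transitivity (iter_integral (fun t : k.+1.-tuple R =>
    (psi (total_time k.+1 (cs \o succn) x t / sigma) *
     pcos_tail k.+1 (cs \o succn) mu sigma x t)%:E)).
  congr (iter_integral _); apply/funext => t.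
  rewrite pcos_tail_cons total_time_cons (ltW ax) /psi -/g; congr EFin.
  by rewrite mulrDl [g * _ / _]mulrAC mulrCA mulrA.
rewrite IH// ?ltW// /G -ge0_integralZl_EFin; first last.
- by rewrite mulr_ge0 ?expR_ge0// ltW// divr_gt0.
- apply/measurable_EFinP; apply: measurable_funM; last exact: measurable_gamma_pdf.
  apply: measurable_funM; first exact: measurable_cst.
  by apply: (measurableT_comp mphi); exact: measurable_funD.
- by move=> y _; rewrite lee_fin !mulr_ge0 ?expR_ge0//; exact: gamma_pdf_ge0.
- exact: measurableT.
apply: eq_integral => y _; rewrite -EFinM; congr EFin.
rewrite /psi; have := @pcos_factorE k.+1 cs mu sigma x s0 xmu.
move: (pcos_factor _ _ _ _ _ _) => A E; rewrite !mulrA; congr (_ * _ * _).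
rewrite mulrC E -/g.
have -> : expR (- (g * (x - mu) / sigma)) = C * expR (- (g / sigma * (x - a))).
  by rewrite /C -expRD; congr expR; rewrite -/g; field; rewrite gt_eqF.
by rewrite [C * _]mulrC !mulrA.
Qed.

End Spacings.

(** * Measurability and continuity *)

(* Avoids splitting the domain at [0], where [x^-1 = 0]. *)
Lemma measurable_invr (R : realType) : measurable_fun [set: R] (fun x : R => x^-1).
Proof.
rewrite (_ : (fun _ => _) = (fun x : R => x * expR (- ln (x ^+ 2)))).
  apply: measurable_funM => //; apply: measurableT_comp => //; apply: measurableT_comp => //.
  by apply: measurableT_comp => //; exact: exprn_measurable.
apply/funext => x; have [->|x0] := eqVneq x 0; first by rewrite invr0 mul0r.
rewrite expRN lnK ?posrE ?exprn_even_gt0//.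
by rewrite expr2 invfM mulrA divff// mul1r.
Qed.

Section MeasurableSets.
Context d (T : measurableType d) (R : realType).
Implicit Types f g : T -> R.

Lemma measurable_set_ler f g : measurable_fun setT f -> measurable_fun setT g ->
  measurable [set w | f w <= g w].
Proof.
move=> mf mg; have := measurable_fun_ler mf mg.
by move=> /(_ measurableT [set true] I); rewrite setTI.
Qed.

Lemma measurable_set_ltr f g : measurable_fun setT f -> measurable_fun setT g ->
  measurable [set w | f w < g w].
Proof.
move=> mf mg; have := measurable_fun_ltr mf mg.
by move=> /(_ measurableT [set true] I); rewrite setTI.
Qed.

Lemma measurable_Fexp (f g : T -> R) (x : R) : measurable_fun setT f ->
  measurable_fun setT g -> measurable_fun setT (fun w => Fexp (f w) (g w) x).
Proof.
move=> mf mg; apply: measurable_fun_ifT.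
- by apply: measurable_fun_ler => //; exact: measurable_cst.
- exact: measurable_cst.
apply: measurable_funB; first exact: measurable_cst.
apply: (measurableT_comp (@measurable_expR R)); apply: measurableT_comp => //.
apply: measurable_funM; first by apply: measurable_funB => //; exact: measurable_cst.
exact: measurableT_comp (@measurable_invr R) mg.
Qed.

End MeasurableSets.

Lemma measurable_nth_tuple (R : realType) (k j : nat) :
  measurable_fun [set: k.-tuple R] (fun t : k.-tuple R => t`_j).
Proof.
have [jk|kj] := ltnP j k.
  rewrite (_ : (fun _ => _) = (@tnth k R ^~ (Ordinal jk))); first exact: measurable_tnth.
  by apply/funext => t; rewrite (tnth_nth 0).
rewrite (_ : (fun _ => _) = cst 0); first exact: measurable_cst.
by apply/funext => t; rewrite nth_default// size_tuple.
Qed.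

Lemma measurable_sighat (R : realType) k cs : measurable_fun [set: k.-tuple R] (sighat k cs).
Proof.
apply: measurable_funM; first exact: measurable_cst.
apply: measurable_sum => j; apply: measurable_funM; first exact: measurable_cst.
by apply: measurable_funB; exact: measurable_nth_tuple.
Qed.

(** * Continuity of the bounding curves in the abscissa *)

Section Continuity.
Context {R : realType}.

Lemma continuous_Fexp (f g : R -> R) (x : R) : {for x, continuous f} ->
  {for x, continuous g} -> (forall y, 0 < g y) ->
  {for x, continuous (fun y => Fexp (f y) (g y) y)}.
Proof.
move=> cf cg g0.
rewrite (_ : (fun _ => _) =
    (fun y => 1 - expR (- (Num.max 0 ((y - f y) / g y))))); last first.
  by apply/funext => y; rewrite FexpE.
apply: cvgB; first exact: cvg_cst.
apply: continuous_cvg; first exact: continuous_expR.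
apply: cvgN; apply: (@continuous_max R R (cst 0) (fun y => (y - f y) / g y)).
  exact: cvg_cst.
apply: cvgM; first by apply: cvgB => //; exact: cvg_id.
by apply: cvgV => //; rewrite gt_eqF.
Qed.

Variables (m n : nat) (c sh a : R).
Hypotheses (m_gt0 : (0 < m)%N) (n_gt0 : (0 < n)%N) (sh_gt0 : 0 < sh).
Hypothesis c_le : c <= cmax m.

Lemma continuous_U3 : continuous (U3 m c a sh).
Proof.
move=> x; apply: continuous_Fexp; [exact: cvg_cst|exact: cvg_cst|].
move=> _; exact: Z0_gt0.
Qed.

Lemma continuous_O3 : continuous (O3 m n c a sh).
Proof.
move=> x; pose s y := Num.max (Zm1 m c sh) (Num.min (Z0 m c sh) (sigstar m n a sh y)).
have s0 y : 0 < s y.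
  by rewrite /s lt_max Zm1_gt0.
have cs : {for x, continuous s}.
  have sE : s = fun y => Num.max (Zm1 m c sh) (- Num.max (- Z0 m c sh) (- sigstar m n a sh y)).
    by apply/funext => y; rewrite /s oppr_max !opprK.
  rewrite sE; apply: (@continuous_max R R (cst _)); first exact: cvg_cst.
  apply: cvgN.
  apply: (@continuous_max R R (cst (- Z0 m c sh)) (fun y => - sigstar m n a sh y)).
    exact: cvg_cst.
  apply: cvgN; apply: cvgM; last exact: cvg_cst.
  apply: cvgD; last exact: cvg_cst.
  apply: cvgM; first exact: cvg_cst.
  by apply: cvgB; [exact: cvg_cst|exact: cvg_id].
rewrite (_ : O3 m n c a sh = fun y => Fexp (a + gfun m n c sh (s y)) (s y) y); last first.
  by apply/funext => y; rewrite O3E.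
apply: continuous_Fexp => //; apply: cvgD; first exact: cvg_cst.
apply: cvgM; last exact: cvg_cst.
apply: cvgD; last exact: cvg_cst.
apply: cvgM => //; apply: cvgB; first exact: cvg_cst.
apply: cvgM; first exact: cvg_cst.
apply: cvgB; first exact: cvg_cst.
exact: (@continuous_comp _ _ _ s (@ln R) x cs (continuous_ln (s0 x))).
Qed.

End Continuity.

(** A violation would hold on a nonempty open set, which contains a rational. This reduces the
    inclusion of a graph in the band to countably many events. *)
Lemma ler_continuous_rat (R : realType) (f g : R -> R) : continuous f -> continuous g ->
  (forall q : rat, f (ratr q) <= g (ratr q)) -> forall x, f x <= g x.
Proof.
move=> cf cg h x; rewrite leNgt; apply/negP => gf.
have op : open [set y | 0 < f y - g y].
  apply: (@open_comp _ _ (fun y => f y - g y) [set z | 0 < z]); last exact: open_gt.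
  by move=> y _; apply: cvgB; [exact: cf|exact: cg].
have [|y [/= fg [q _ qy]]] := @dense_rat R _ _ op.
  by exists x; rewrite /= subr_gt0.
by move: fg; rewrite -qy subr_gt0 ltNge h.
Qed.

(* Since [ln] vanishes on nonpositive numbers, membership of [(mu, sigma)]
   in [C3] is affine in [mu] when [sh <= 0], and two abscissas decide it. *)
Lemma graph_B3_sh_le0 (R : realType) (m n : nat) (c a sh mu sigma : R) :
  (0 < n)%N -> c < 0 -> sh <= 0 -> 0 < sigma ->
  graph (Fexp mu sigma) `<=` B3 m n c a sh <-> C3 m n c a sh mu sigma.
Proof.
move=> n_gt0 c0 sh0 s0; split => [h|h]; last by move=> xy hxy; exists mu, sigma.
have n0 : 0 < n%:R :> R by rewrite ltr0n.
have ln0' s : 0 < s -> ln (sh / s) = 0 :> R.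
  by move=> sp; apply: ln0; rewrite pmulr_lle0 ?invr_gt0.
(* With the logarithm equal to 0, the constraint reads [a + m * sh / n <= mu - c * sigma / n]. Any
   graph meeting the given one at abscissa [x0] has the same right-hand side, so the constraint
   transfers from the member found there. *)
pose x0 := mu - c * sigma / n%:R.
have x0mu : mu < x0 by rewrite /x0 ltrDl oppr_gt0 pmulr_llt0 ?invr_gt0// pmulr_llt0.
split => //.
  (* At abscissa [mu] the ordinate is 0, which forces [mu <= m1], hence [mu <= a]. *)
  have [m1 [s1 [[m1a s10 _]]]] : B3 m n c a sh (mu, Fexp mu sigma mu) by apply: h.
  rewrite /graph /= /Fexp lexx; case: leP => [mum1 _|m1mu e]; first exact: le_trans m1a.
  have : expR (- ((mu - m1) / s1)) < 1 by rewrite expR_lt1 oppr_lt0 divr_gt0// subr_gt0.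
  lra.
have [m1 [s1 [[m1a s10 hc]]]] : B3 m n c a sh (x0, Fexp mu sigma x0) by apply: h.
rewrite /graph /= /Fexp leNgt x0mu /=.
have e : (x0 - mu) / sigma = - c / n%:R.
  by rewrite /x0; field; rewrite !gt_eqF.
rewrite e; case: leP => [_ e0|m1x0].
  have : expR (- (- c / n%:R)) < 1 by rewrite expR_lt1 oppr_lt0 divr_gt0// oppr_gt0.
  lra.
move=> /addrI/oppr_inj/expR_inj/oppr_inj e1.
move: hc; rewrite !ln0'// !mulr0 !sub0r.
rewrite -!mulNr !ler_pdivlMr// => hc.
have e2 : n%:R * (x0 - m1) = - c * s1.
  have : (x0 - m1) / s1 * s1 * n%:R = - c / n%:R * s1 * n%:R by rewrite -e1.
  rewrite divfK ?gt_eqF// => e3; rewrite mulrC e3; field; rewrite !gt_eqF//.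
have e4 : n%:R * (x0 - mu) = - c * sigma.
  by rewrite /x0; field; rewrite !gt_eqF.
nra.
Qed.

(** * Joint law of the estimators *)

(** Indeed [ln (1 + 1 / k) <= 1 / k < 1]. It makes the quantile negative, as the case [sh <= 0]
    requires. *)
Lemma cmax_lt0 (R : realType) (k : nat) : (1 < k)%N -> cmax k < 0 :> R.
Proof.
move=> k1; rewrite /cmax pmulr_rlt0 ?ltr0n// subr_lt0.
have k0 : 0 < k%:R :> R by rewrite ltr0n (ltn_trans _ k1).
have -> : k.+1%:R / k%:R = 1 + k%:R^-1 :> R.
  by rewrite -addn1 natrD; field; rewrite gt_eqF.
have kp : 0 < k%:R^-1 :> R by rewrite invr_gt0.
apply: (@le_lt_trans _ _ k%:R^-1).
  by apply: le_ln1Dx; apply: lt_trans kp; rewrite oppr_lt0.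
by rewrite invf_lt1// ltr1n.
Qed.

(** The bound [ln u <= u - 1] at [u = k * y / (k + 1)]. *)
Lemma le_cmax (R : realType) (k : nat) (y : R) : (0 < k)%N -> 0 < y ->
  k.+1%:R * ln y - k%:R * y <= cmax k.
Proof.
move=> k0 y0; have k0' : 0 < k%:R :> R by rewrite ltr0n.
have k1 : 0 < k.+1%:R :> R by rewrite ltr0n.
have h : ln (y * (k%:R / k.+1%:R)) <= y * (k%:R / k.+1%:R) - 1.
  have := @le_ln1Dx R (y * (k%:R / k.+1%:R) - 1); rewrite addrCA subrr addr0; apply.
  by rewrite ltrBrDl addrN mulr_gt0// divr_gt0.
move: h; rewrite lnM ?posrE ?divr_gt0// -invf_div lnV ?posrE ?divr_gt0//.
set L := ln (_ / _) => h.
rewrite /cmax -/L -subr_ge0.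
have -> : k.+1%:R * (L - 1) - (k.+1%:R * ln y - k%:R * y) =
    k.+1%:R * ((y * (k.+1%:R / k%:R)^-1 - 1) - (ln y - L)).
  by move: (k.+1%:R) k1 => K K0; field; rewrite !gt_eqF.
by rewrite mulr_ge0 ?(ltW k1)// subr_ge0.
Qed.

Section Law.
Context {R : realType}.
Notation lambda := (@lebesgue_measure R).
Variables (m n : nat) (cs : nat -> nat) (mu sigma : R).
Hypotheses (m_gt1 : (1 < m)%N) (m_le_n : (m <= n)%N).
Hypothesis sum_cs : (\sum_(i < m) cs i)%N = (n - m)%N.
Hypothesis sigma_gt0 : 0 < sigma.
Context d (Omega : measurableType d) (P : probability Omega R).
Variable X : Omega -> m.-tuple R.
Hypothesis mX : measurable_fun [set: Omega] X.
Hypothesis dX : has_joint_density P X (pcos_density m cs mu sigma).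

Let Y w := sighat m cs (X w) / sigma.
Let Z w := n%:R * (muhat m (X w) - mu) / sigma.

Lemma gam_first : gam m cs 0 = n.
Proof.
rewrite /gam big_mkord; under eq_bigr do rewrite -add1n.
by rewrite big_split /= sum_cs sum1_card card_ord subnKC.
Qed.

(** Given the minimum [x], the later spacings contribute a Gamma(m - 1, 1) variable and a survival
    factor; the latter turns the law of [x] into an exponential of rate [n / sigma] started at [mu].
    Rescaling by [1 / m] and Tonelli finish. *)
Lemma law_mle (D : set (R * R)) : measurable D ->
  P [set w | D (Y w, Z w)] =
  (\int[lambda]_y \int[lambda]_z
     (\1_D (y, z) * gamma_pdf m.-1 m%:R^-1 y * fexp 0 1 z)%:E)%E.
Proof.
move=> mD.
case: m m_gt1 m_le_n sum_cs gam_first X mX dX @Y @Z => [//|[//|k]] _ mn scs g0 X' mX' dX' Y' Z'.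
pose A := [set t : k.+2.-tuple R | D (sighat k.+2 cs t / sigma,
  n%:R * (muhat k.+2 t - mu) / sigma)].
have n0 : 0 < n%:R :> R by rewrite ltr0n (leq_trans _ mn).
have M0 : 0 < k.+2%:R :> R by rewrite ltr0n.
have mA : measurable A.
  pose ST (t : k.+2.-tuple R) :=
    (sighat k.+2 cs t / sigma, n%:R * (muhat k.+2 t - mu) / sigma).
  have mST : measurable_fun setT ST.
    apply: measurable_fun_pair.
      by apply: measurable_funM; [exact: measurable_sighat|exact: measurable_cst].
    apply: measurable_funM; last exact: measurable_cst.
    apply: measurable_funM; first exact: measurable_cst.
    by apply: measurable_funB; [exact: measurable_nth_tuple|exact: measurable_cst].
  by have := mST measurableT D mD; rewrite setTI.
have -> : [set w | D (Y' w, Z' w)] = X' @^-1` A by [].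
rewrite (dX' A mA) iter_integralS.
have m1D : measurable_fun [set: R * R] (\1_D : R * R -> R) by exact: measurable_indic.
(* What remains after integrating out all spacings but the first, whose normalized value is [z]. *)
pose G z := (\int[lambda]_y (\1_D (k.+2%:R^-1 * y, z) * gamma_pdf k.+1 1 y)%:E)%E.
have G0 z : (0 <= G z)%E.
  by apply: integral_ge0 => y _; rewrite lee_fin mulr_ge0//; exact: gamma_pdf_ge0.
have mK1 : measurable_fun [set: R * R]
    (fun zy : R * R => (\1_D (k.+2%:R^-1 * zy.2, zy.1) : R)).
  apply: (measurableT_comp m1D); apply: measurable_fun_pair => //.
  by apply: measurable_funM => //; exact: measurable_cst.
have mG : measurable_fun [set: R] G.
  pose K (zy : R * R) := (\1_D (k.+2%:R^-1 * zy.2, zy.1) * gamma_pdf k.+1 1 zy.2)%:E.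
  have mK : measurable_fun [set: R * R] K.
    apply/measurable_EFinP; apply: measurable_funM; first exact: mK1.
    exact: measurableT_comp (measurable_gamma_pdf _ _) measurable_snd.
  apply: (measurable_fun_fubini_tonelli_F (m2 := lambda) K mK) => -[z y].
  by rewrite lee_fin mulr_ge0//; exact: gamma_pdf_ge0.
rewrite (@integral_exp_shift _ _ G mu (n%:R / sigma)) //; first last.
- move=> x xmu.
  pose phi y : R := pcos_factor k.+2 cs mu sigma 0 x *
    \1_D (k.+2%:R^-1 * y, n%:R / sigma * (x - mu)).
  have mphi : measurable_fun [set: R] phi.
    apply: measurable_funM; first exact: measurable_cst.
    by apply: (measurableT_comp m1D); apply: measurable_fun_pair => //;
      apply: measurable_funM => //; exact: measurable_cst.
  have phi0 y : 0 <= phi y by rewrite mulr_ge0// pcos_factor_ge0.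
  transitivity (iter_integral (fun t : k.+1.-tuple R =>
      (phi (total_time k.+1 (cs \o succn) x t / sigma) *
       pcos_tail k.+1 (cs \o succn) mu sigma x t)%:E)).
    congr (iter_integral _); apply/funext => t; congr EFin.
    rewrite pcos_density_cons /phi mulrCA mulrA; congr (_ * _ * _).
    rewrite !indicE; congr (_%:R); congr nat_of_bool.
    rewrite [n%:R / _ * _]mulrAC mulrA -(@sighat_cons R k.+1 cs x t).
    by apply/idP/idP; rewrite !inE.
  rewrite iter_integral_total_time// ?(ltW xmu)// /G -ge0_integralZl_EFin; first last.
  + by rewrite mulr_ge0 ?expR_ge0// ltW// divr_gt0.
  + apply/measurable_EFinP; apply: measurable_funM; last exact: measurable_gamma_pdf.
    by apply: (measurableT_comp m1D); apply: measurable_fun_pair => //;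
      apply: measurable_funM => //; exact: measurable_cst.
  + by move=> y _; rewrite lee_fin mulr_ge0//; exact: gamma_pdf_ge0.
  + exact: measurableT.
  apply: eq_integral => y _; rewrite -EFinM; congr EFin.
  rewrite /phi; have := @pcos_factorE _ k.+1 cs mu sigma x sigma_gt0 xmu.
  move: (pcos_factor _ _ _ _ _ _) => B E; rewrite !mulrA; congr (_ * _ * _).
  by rewrite mulrC E g0 [_ / sigma * (x - mu)]mulrAC.
- move=> x xmu; rewrite -[RHS](@iter_integral0 R k.+1).
  congr (iter_integral _); apply/funext => t.
  by rewrite pcos_density_cons /pcos_factor /fexp (ltW xmu) mulr0 !mul0r mulr0.
- by rewrite divr_gt0.
have GE z : G z = (\int[lambda]_y (\1_D (y, z) * gamma_pdf k.+1 k.+2%:R^-1 y)%:E)%E.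
  pose f (y : R) := (\1_D (k.+2%:R^-1 * y, z) * gamma_pdf k.+1 1 y)%:E.
  have mf : measurable_fun [set: R] f.
    apply/measurable_EFinP; apply: measurable_funM; last exact: measurable_gamma_pdf.
    by apply: (measurableT_comp m1D); apply: measurable_fun_pair => //;
      apply: measurable_funM => //; exact: measurable_cst.
  have f0 y : (0 <= f y)%E by rewrite lee_fin mulr_ge0//; exact: gamma_pdf_ge0.
  have mf' : measurable_fun [set: R] (fun y : R => f (k.+2%:R * (y - 0))).
    apply: (measurableT_comp mf); apply: measurable_funM; first exact: measurable_cst.
    exact: measurable_funB.
  have E := @ge0_integral_affine R 0 k.+2%:R f M0 mf f0.
  transitivity (k.+2%:R%:E * \int[lambda]_y f (k.+2%:R * (y - 0))%R)%E.
    by rewrite E muleA -EFinM divff ?gt_eqF// mul1e.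
  rewrite -ge0_integralZl_EFin//.
  apply: eq_integral => y _; rewrite /f -EFinM subr0 mulKf ?gt_eqF//.
  by rewrite gamma_pdf_scale//; congr EFin; rewrite mulrCA.
pose H (zy : R * R) :=
  (\1_D (zy.2, zy.1) * gamma_pdf k.+1 k.+2%:R^-1 zy.2 * gamma_pdf 1 1 zy.1)%:E.
have g10 z : 0 <= gamma_pdf 1 1 z :> R by exact: gamma_pdf_ge0.
have gk0 y : 0 <= gamma_pdf k.+1 k.+2%:R^-1 y :> R.
  by apply: gamma_pdf_ge0; rewrite invr_ge0 ltW.
have H0 zy : (0 <= H zy)%E by rewrite lee_fin !mulr_ge0.
have mDz : measurable_fun [set: R * R] (fun zy : R * R => (\1_D (zy.2, zy.1) : R)).
  by apply: (measurableT_comp m1D); exact: measurable_fun_pair.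
have mH : measurable_fun [set: R * R] H.
  apply/measurable_EFinP; apply: measurable_funM.
    apply: measurable_funM; first exact: mDz.
    exact: measurableT_comp (measurable_gamma_pdf _ _) measurable_snd.
  exact: measurableT_comp (measurable_gamma_pdf _ _) measurable_fst.
transitivity (\int[lambda]_z \int[lambda]_y H (z, y))%E.
  apply: eq_integral => z _; rewrite GE.
  rewrite -ge0_integralZl_EFin//.
  - by apply: eq_integral => y _; rewrite -EFinM mulrC.
  - by move=> y _; rewrite lee_fin mulr_ge0.
  - apply/measurable_EFinP; apply: measurable_funM; last exact: measurable_gamma_pdf.
    exact: measurable_fun_pair1 m1D.
rewrite (fubini_tonelli (m1 := lambda) (m2 := lambda) H mH H0).
by apply: eq_integral => y _; apply: eq_integral => z _; rewrite /H /= fexp01.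
Qed.

End Law.

(** * Coverage *)

Section Quantile.
Context {R : realType}.
Notation lambda := (@lebesgue_measure R).
Variables (m n : nat) (cs : nat -> nat) (mu sigma p : R).
Hypotheses (m_gt1 : (1 < m)%N) (m_le_n : (m <= n)%N).
Hypothesis sum_cs : (\sum_(i < m) cs i)%N = (n - m)%N.
Hypothesis p01 : 0 < p < 1.
Hypothesis sigma_gt0 : 0 < sigma.
Context d (Omega : measurableType d) (P : probability Omega R).
Variable X : Omega -> m.-tuple R.
Hypothesis mX : measurable_fun [set: Omega] X.
Hypothesis dX : has_joint_density P X (pcos_density m cs mu sigma).

Let Y w := sighat m cs (X w) / sigma.
Let Z w := n%:R * (muhat m (X w) - mu) / sigma.
Let T w := m.+1%:R * ln (Y w) - m%:R * Y w - Z w.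

Lemma measurable_muhat_comp : measurable_fun [set: Omega] (fun w => muhat m (X w)).
Proof. exact: measurableT_comp (@measurable_nth_tuple R m 0) mX. Qed.

Lemma measurable_sighat_comp : measurable_fun [set: Omega] (fun w => sighat m cs (X w)).
Proof. exact: measurableT_comp (@measurable_sighat R m cs) mX. Qed.

Let mY : measurable_fun [set: Omega] Y.
Proof. by apply: measurable_funM; [exact: measurable_sighat_comp|exact: measurable_cst]. Qed.

Let mZ : measurable_fun [set: Omega] Z.
Proof.
apply: measurable_funM; last exact: measurable_cst.
apply: measurable_funM; first exact: measurable_cst.
by apply: measurable_funB; [exact: measurable_muhat_comp|exact: measurable_cst].
Qed.

Let mpivot d' (U : measurableType d') (f g : U -> R) :
  measurable_fun setT f -> measurable_fun setT g ->
  measurable_fun setT (fun u => m.+1%:R * ln (f u) - m%:R * f u - g u).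
Proof.
move=> mf mg; apply: measurable_funB; last exact: mg.
apply: measurable_funB; apply: measurable_funM; [exact: measurable_cst| |exact: measurable_cst|exact: mf].
exact: measurableT_comp (@measurable_ln R) mf.
Qed.

Let mT : measurable_fun [set: Omega] T.
Proof. exact: mpivot. Qed.

Let measurable_pivot_le c : measurable [set w | T w <= c].
Proof. by apply: measurable_set_ler => //; exact: measurable_cst. Qed.

Let law (D : set (R * R)) : measurable D -> P [set w | D (Y w, Z w)] =
  (\int[lambda]_y \int[lambda]_z
     (\1_D (y, z) * gamma_pdf m.-1 m%:R^-1 y * fexp 0 1 z)%:E)%E.
Proof.
exact: (@law_mle R m n cs mu sigma m_gt1 m_le_n sum_cs sigma_gt0 d Omega P X mX dX D).
Qed.

Lemma law_pivot c : P [set w | T w <= c] = T_cdf m c.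
Proof.
pose D := [set yz : R * R | m.+1%:R * ln yz.1 - m%:R * yz.1 - yz.2 <= c].
have mD : measurable D.
  by apply: measurable_set_ler; [exact: mpivot|exact: measurable_cst].
have -> : [set w | T w <= c] = [set w | D (Y w, Z w)] by [].
rewrite (law _ mD) /T_cdf.
apply: eq_integral => y _; apply: eq_integral => z _.
rewrite indicE; case: ifP => h; first by rewrite mem_set.
by rewrite memNset// /D /= h.
Qed.

(* The density of [(Y, Z)] vanishes off the open positive quadrant. *)
Lemma law_quadrant (D : set (R * R)) : measurable D ->
  (forall y z, 0 < y -> 0 < z -> D (y, z)) -> P [set w | D (Y w, Z w)] = 1%E.
Proof.
move=> mD hD; rewrite -(probability_setT P).
have -> : [set: Omega] = [set w | (setT : set (R * R)) (Y w, Z w)] by [].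
rewrite (law _ mD) (law _ measurableT).
apply: eq_integral => y _; apply: eq_integral => z _; congr EFin.
rewrite /gamma_pdf /fexp; case: (ltP 0 y) => y0; last by rewrite !mulr0 !mul0r.
case: (leP z 0) => z0; first by rewrite !mulr0.
by rewrite !indicE !mem_set//; exact: hD.
Qed.

Lemma T_cdf_cmax : T_cdf m (cmax m) = 1%E :> \bar R.
Proof.
rewrite -law_pivot.
apply: (law_quadrant [set yz : R * R | m.+1%:R * ln yz.1 - m%:R * yz.1 - yz.2 <= cmax m]).
  by apply: measurable_set_ler; [exact: mpivot|exact: measurable_cst].
move=> y z y0 z0 /=; rewrite lerBlDr (le_trans (@le_cmax R m y _ y0)) ?(ltnW m_gt1)//.
by rewrite lerDl ltW.
Qed.

Let le_T_cdf (c c' : R) : c <= c' -> (T_cdf m c <= T_cdf m c')%E.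
Proof.
move=> cc'; rewrite -!law_pivot; apply: le_measure; rewrite ?inE//.
by move=> w /= /le_trans; apply.
Qed.

(** Needed for the infimum [cp] to be a genuine greatest lower bound. The events [T <= - k] decrease
    to the empty set, so their probabilities drop below [p]. *)
Let has_lbound_T_cdf : has_lbound [set c | (p%:E <= T_cdf m c)%E].
Proof.
have /andP[p0 _] := p01.
pose F k := [set w | T w <= - k%:R].
have F0 : \bigcap_k F k = set0.
  rewrite -subset0 => w /(_ (Num.bound (T w)) Logic.I); rewrite /F /= => h.
  have := unstable.ltrNbound (T w).
  by rewrite ltNge lerNr h.
have : (P \o F) k @[k --> \oo] --> P (\bigcap_k F k).
  apply: nonincreasing_cvg_mu => //.
  - by rewrite (le_lt_trans (probability_le1 P _))// ?ltry//; exact: measurable_pivot_le.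
  - by move=> k; exact: measurable_pivot_le.
  - by rewrite F0.
  - move=> i j ij; rewrite subsetEset => w /= h; apply: le_trans h _.
    by rewrite lerN2 ler_nat.
rewrite F0 measure0 => cvgF.
have [k hk] : exists k, (P (F k) < p%:E)%E.
  apply: contrapT => /forallNP h; have : (p%:E <= 0)%E.
    by apply: cvge_ge cvgF; near=> k; rewrite leNgt; apply/negP; exact: h.
  by rewrite lee_fin leNgt p0.
exists (- k%:R) => c /= hc; rewrite leNgt; apply/negP => /ltW ck.
have := le_trans hc (le_T_cdf _ _ ck).
by rewrite -law_pivot leNgt hk.
Unshelve. all: by end_near.
Qed.

(** The cdf of the pivot already equals 1 at [cmax m]; this provides the bound on [c] assumed in the
    description of the band. *)
Lemma cp_le_cmax : cp m p <= cmax m.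
Proof.
apply: (ge_inf has_lbound_T_cdf); rewrite /= T_cdf_cmax lee_fin ltW//.
by case/andP: p01.
Qed.

(** The strict event is the increasing union of the events [T <= cp m p - 1 / (k + 1)], each of
    probability below [p] since [cp m p] is a lower bound. *)
Lemma pivot_lt_cp : (P [set w | (T w < cp m p)%R] <= p%:E)%E.
Proof.
pose F k := [set w | T w <= cp m p - k.+1%:R^-1].
have FE : [set w | T w < cp m p] = \bigcup_k F k.
  apply/seteqP; split => w /=; last first.
    move=> [k _]; rewrite /F /= => h; apply: le_lt_trans h _.
    by rewrite ltrBlDr ltrDl invr_gt0 ltr0n.
  rewrite -subr_gt0 => h.
  have [k hk] := @ltr_add_invr R 0 _ h; exists k => //.
  by rewrite /F /= lerBrDr -lerBrDl ltW//; rewrite add0r in hk.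
rewrite FE; have : (P \o F) k @[k --> \oo] --> P (\bigcup_k F k).
  apply: nondecreasing_cvg_mu => //.
  - by move=> k; exact: measurable_pivot_le.
  - by apply: bigcupT_measurable => k; exact: measurable_pivot_le.
  - move=> i j ij; rewrite subsetEset => w /= h; apply: le_trans h _.
    by rewrite lerB// lef_pV2 ?posrE ?ltr0n// ler_nat.
apply: cvge_le; near=> k; rewrite /= /F law_pivot leNgt; apply/negP => h.
have := ge_inf has_lbound_T_cdf (ltW h); rewrite -/(cp m p).
by rewrite lerBrDr gerDl leNgt invr_gt0 ltr0n.
Unshelve. all: by end_near.
Qed.

Lemma C3_pivot c w :
  C3 m n c (muhat m (X w)) (sighat m cs (X w)) mu sigma <->
  mu <= muhat m (X w) /\ c <= T w.
Proof.
have -> : T w = m.+1%:R * ln (sighat m cs (X w) / sigma) -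
    (n%:R * (muhat m (X w) - mu) + m%:R * sighat m cs (X w)) / sigma.
  by rewrite /T /Y /Z; lra.
by split=> [[]|[]].
Qed.

Lemma measurable_C3 c :
  measurable [set w | C3 m n c (muhat m (X w)) (sighat m cs (X w)) mu sigma].
Proof.
rewrite (_ : [set w | _] = [set w | mu <= muhat m (X w)] `&` [set w | c <= T w]).
  apply: measurableI; apply: measurable_set_ler => //; try exact: measurable_cst.
  exact: measurable_muhat_comp.
by apply/seteqP; split => w /C3_pivot.
Qed.

Lemma C3_level :
  ((1 - p)%:E <=
   P [set w | C3 m n (cp m p) (muhat m (X w)) (sighat m cs (X w)) mu sigma])%E.
Proof.
set E := [set w | _].
have mE : measurable E := measurable_C3 _.
have mTlt : measurable [set w | T w < cp m p].
  by apply: measurable_set_ltr => //; exact: measurable_cst.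
have mZpos : measurable [set w | 0 < Z w].
  by apply: measurable_set_ltr => //; exact: measurable_cst.
have Zpos : P [set w | 0 < Z w] = 1%E.
  apply: (law_quadrant [set yz : R * R | 0 < yz.2]) => //.
  by apply: measurable_set_ltr; [exact: measurable_cst|exact: measurable_snd].
have h : (P (~` E) <= p%:E)%E.
  apply: le_trans pivot_lt_cp.
  (* Either the pivot falls below its quantile or the null event [Z <= 0] occurs, for [0 < Z]
     already yields [mu <= muhat]. *)
  have : ~` E `<=` [set w | T w < cp m p] `|` ~` [set w | 0 < Z w].
    move=> w; rewrite /E /= => nE; have [Z0|] := boolP (0 < Z w); last by right; apply/negP.
    left; rewrite ltNge; apply/negP => cT; apply: nE; apply/C3_pivot => //; split => //.
    have n0 : 0 < n%:R :> R by rewrite ltr0n (leq_trans _ m_le_n)// ltnW.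
    by move: Z0; rewrite /Z pmulr_lgt0 ?invr_gt0// pmulr_rgt0// subr_gt0 => /ltW.
  move=> sub; apply: (@le_trans _ _ (P ([set w | T w < cp m p] `|` ~` [set w | 0 < Z w]))).
    apply: le_measure; rewrite ?inE//; first exact: measurableC.
    by apply: measurableU => //; exact: measurableC.
  apply: le_trans (measureU2 _ _ _) _ => //; first exact: measurableC.
  have PC : P (~` [set w | 0 < Z w]) = 0%E by rewrite probability_setC// Zpos subee.
  by rewrite [X in (_ + X)%E](_ : _ = 0%E) ?adde0//; exact: PC.
move: h; rewrite probability_setC//.
have := fin_num_measure P E mE => /fineK <-.
by rewrite -EFinB !lee_fin lerBlDr addrC -lerBlDr.
Qed.

Lemma sighat_pos : P [set w | 0 < sighat m cs (X w)] = 1%E.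
Proof.
rewrite -(law_quadrant [set yz : R * R | 0 < yz.1])//.
  have YE w : (0 < Y w) = (0 < sighat m cs (X w)).
    by apply: pmulr_lgt0; rewrite invr_gt0.
  by congr (P _); apply/funext => w /=; rewrite YE.
by apply: measurable_set_ltr; [exact: measurable_cst|exact: measurable_fst].
Qed.

(** Where the scale estimate is positive, the band lies between continuous curves and rational
    abscissas suffice. On the remaining event the inclusion amounts to membership in [C3]. *)
Lemma measurable_graph_B3 c : c <= cmax m ->
  measurable [set w | graph (Fexp mu sigma) `<=`
    B3 m n c (muhat m (X w)) (sighat m cs (X w))].
Proof.
move=> c_le; have m_gt0 : (0 < m)%N := ltnW m_gt1.
have n_gt0 : (0 < n)%N := leq_trans m_gt0 m_le_n.
have c0 : c < 0 := le_lt_trans c_le (@cmax_lt0 R m m_gt1).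
set a := fun w => muhat m (X w); set b := fun w => sighat m cs (X w).
have ma : measurable_fun setT a := measurable_muhat_comp.
have mb : measurable_fun setT b := measurable_sighat_comp.
pose V := [set w | 0 < b w].
have mV : measurable V by apply: measurable_set_ltr => //; exact: measurable_cst.
pose Q q := [set w | U3 m c (a w) (b w) (ratr q) <= Fexp mu sigma (ratr q)] `&`
  [set w | Fexp mu sigma (ratr q) <= O3 m n c (a w) (b w) (ratr q)].
have mZ0 : measurable_fun setT (fun w => Z0 m c (b w)).
  apply: measurable_funM; last exact: measurable_cst.
  apply: measurableT_comp => //; apply: measurable_funM; last exact: measurable_cst.
  by apply: measurable_funM => //; exact: measurable_cst.
have mZm1 : measurable_fun setT (fun w => Zm1 m c (b w)).
  apply: measurable_funM; last exact: measurable_cst.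
  apply: measurableT_comp => //; apply: measurable_funM; last exact: measurable_cst.
  by apply: measurable_funM => //; exact: measurable_cst.
have mQ q : measurable (Q q).
  have ms : measurable_fun setT (fun w => sigstar m n (a w) (b w) (ratr q)).
    apply: measurable_funM; last exact: measurable_cst.
    apply: measurable_funD; apply: measurable_funM => //; try exact: measurable_cst.
    by apply: measurable_funB => //; exact: measurable_cst.
  apply: measurableI; apply: measurable_set_ler; try exact: measurable_cst.
    exact: measurable_Fexp.
  apply: measurable_fun_ifT; first exact: measurable_fun_ltr.
    exact: measurable_Fexp.
  apply: measurable_fun_ifT; first exact: measurable_fun_ler.
    apply: measurable_Fexp => //; apply: measurable_funD => //.
    apply: measurable_funM; last exact: measurable_cst.
    apply: measurable_funD.
      apply: measurable_funM => //; apply: measurable_funB; first exact: measurable_cst.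
      apply: measurable_funM; first exact: measurable_cst.
      by apply: measurable_funB; apply: measurableT_comp (@measurable_ln R) _.
    by apply: measurable_funM => //; exact: measurable_cst.
  exact: measurable_Fexp.
rewrite (_ : [set w | _] = (V `&` \bigcap_q Q q) `|`
    (~` V `&` [set w | C3 m n c (a w) (b w) mu sigma])); last first.
  apply/seteqP; split => w /=.
    have [bw|bw] := ltP 0 (b w); last first.
      move=> h; right; split; first by rewrite /V /= ltNge bw.
      by apply/(graph_B3_sh_le0 _ _ _ _ _ _ _ _ n_gt0 c0 bw sigma_gt0).
    move=> h; left; split => // q _.
    have := h (ratr q, Fexp mu sigma (ratr q)) erefl.
    by rewrite B3E// => -[_ /andP[]].
  move=> [[bw hI]|[/negP]].
    have cF : continuous (Fexp mu sigma).
      by move=> x; apply: continuous_Fexp => //; exact: cvg_cst.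
    have UF := @ler_continuous_rat R _ _ (continuous_U3 _ _ _ (a w) m_gt0 bw c_le) cF
      (fun q => proj1 (hI q Logic.I)).
    have FO := @ler_continuous_rat R _ _ cF
      (continuous_O3 _ _ _ _ (a w) m_gt0 n_gt0 bw c_le) (fun q => proj2 (hI q Logic.I)).
    move=> [x y]; rewrite /graph /= => ->; rewrite B3E//=.
    by rewrite Fexp_ge0// (ltW (Fexp_lt1 _ _ _)) UF FO.
  rewrite -leNgt => bw hC.
  by apply/(graph_B3_sh_le0 _ _ _ _ _ _ _ _ n_gt0 c0 bw sigma_gt0).
apply: measurableU; apply: measurableI => //; last exact: measurable_C3.
- rewrite -[X in measurable X]setCK setC_bigcap.
  by apply/measurableC/bigcupT_measurable_rat => q; exact: measurableC.
- exact: measurableC.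
Qed.

End Quantile.

Theorem theorem2 (R : realType) (m n : nat) (cs : nat -> nat) (p : R) :
  (1 < m)%N -> (m <= n)%N -> (\sum_(i < m) cs i)%N = (n - m)%N ->
  0 < p < 1 ->
  forall mu sigma : R, 0 < sigma ->
  forall (d : measure_display) (Omega : measurableType d)
    (P : probability Omega R) (X : Omega -> m.-tuple R),
  measurable_fun [set: Omega] X ->
  has_joint_density P X (pcos_density m cs mu sigma) ->
  let c := cp m p in
  let band := fun w : Omega => B3 m n c (muhat m (X w)) (sighat m cs (X w)) in
  [/\ measurable [set w | graph (Fexp mu sigma) `<=` band w],
      ((1 - p)%:E <= P [set w | graph (Fexp mu sigma) `<=` band w])%E,
      P [set w | 0 < sighat m cs (X w)] = 1%E,
      (forall w, 0 < sighat m cs (X w) -> forall x y1 y2 y : R,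
          band w (x, y1) -> band w (x, y2) -> y1 <= y <= y2 -> band w (x, y)) &
      (forall w, 0 < sighat m cs (X w) ->
          band w = [set xy : R * R | 0 <= xy.2 <= 1 /\
             U3 m c (muhat m (X w)) (sighat m cs (X w)) xy.1 <= xy.2
             <= O3 m n c (muhat m (X w)) (sighat m cs (X w)) xy.1])].
Proof.
move=> m_gt1 m_le_n sum_cs p01 mu sigma s0 d Omega P X mX dX c band.
have m_gt0 : (0 < m)%N := ltnW m_gt1.
have n_gt0 : (0 < n)%N := leq_trans m_gt0 m_le_n.
have c_le : c <= cmax m.
  exact: (@cp_le_cmax R m n cs mu sigma p m_gt1 m_le_n sum_cs p01 s0 d Omega P X mX dX).
have mband : measurable [set w | graph (Fexp mu sigma) `<=` band w].
  apply: measurable_graph_B3; try assumption.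
have bandE w : 0 < sighat m cs (X w) -> band w = _ := fun h => B3E m n c _ m_gt0 n_gt0 h c_le _.
split => //.
(* Whenever [C3] contains the true parameter, its graph is one of those forming the band. *)
- apply: le_trans (@C3_level R m n cs mu sigma p m_gt1 m_le_n sum_cs p01 s0 d Omega P X mX dX) _.
  apply: le_measure; rewrite ?inE//; first exact: measurable_C3.
  by move=> w /= h xy hxy; exists mu, sigma.
- exact: (@sighat_pos R m n cs mu sigma m_gt1 m_le_n sum_cs s0 d Omega P X mX dX).
- move=> w /bandE -> x y1 y2 y /= [/andP[h1 _] /andP[h2 _]] [/andP[_ h3] /andP[_ h4]].
  move=> /andP[h5 h6]; split; first by rewrite (le_trans h1 h5) (le_trans h6 h3).
  by rewrite (le_trans h2 h5) (le_trans h6 h4).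
Qed.
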